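(* For every $n\ge1$, the generating function $\sum_A\mathrm{W}(A)$ of arrowed monotone triangles with bottom row $(1,2,\dots,n)$ equals the generating function $\sum_D\mathrm{W}(D)$ of set-valued near-balanced column strict plane partitions of order $n$ (as polynomials/Laurent polynomials in $u,v,w,X_1,\dots,X_n$).
   Context: A monotone triangle with $n$ rows is a triangular array of integers $(m_{i,j})_{1\le j\le i\le n}$ with $m_{i+1,j}\le m_{i,j}\le m_{i+1,j+1}$ and $m_{i,j}<m_{i,j+1}$; row $n$ is the bottom row. The northwest-neighbour of $m_{i,j}$ is $m_{i-1,j-1}$, its northeast-neighbour $m_{i-1,j}$. An arrowed monotone triangle is a monotone triangle in which every entry carries a decoration from $\{\nwarrow,\nearrow,\nwarrow\!\nearrow\}$ such that: if an entry equals its northwest-neighbour then it carries $\nearrow$; if it equals its northeast-neighbour then it carries $\nwarrow$. Its weight is $\mathrm{W}(A)=u^{\#\nearrow}v^{\#\nwarrow}w^{\#\nwarrow\nearrow}\prod_{i=1}^n X_i^{(\text{sum of row } i)-(\text{sum of row } i-1)+(\#\nearrow\text{ in row } i)-(\#\nwarrow\text{ in row } i)}$ (counts are of entries with exactly that decoration; sum of row $0$ is $0$). A partition $\lambda=(a_1,\dots,a_l\mid b_1,\dots,b_l)$ in Frobenius notation is near-balanced if $a_i\in\{b_i,b_i+1\}$ for all $i$; $\mathrm{W}(\lambda)=w^{l+\sum_i(b_i-a_i)}$. An SBCSPP of order $n$ and near-balanced shape $\lambda$ is a filling of the cells of $\lambda$ with nonempty subsets of $\{1,\dots,n\}$, singletons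 strictly above the main diagonal, maxima weakly decreasing along rows, and for vertically adjacent cells all elements of the upper cell strictly larger than all elements of the lower cell. Its weight is $\mathrm{W}(D)=\mathrm{W}(\lambda)\,u^{\#\text{cells strictly above diagonal}}\,v^{\binom{n+1}{2}-\#\text{entries in cells on or below diagonal}}\,w^{\#\text{entries}-\#\text{cells}}\prod_iX_i^{\#\,i\text{'s in }D}$, where entries are the integers in the sets. *)

(* Defs.v *)
From HB Require Import structures.
From mathcomp Require Import all_boot all_order all_algebra.
Set Implicit Arguments. Unset Strict Implicit. Unset Printing Implicit Defensive.
Import Order.TTheory GRing.Theory Num.Theory.

Inductive deco := DNW | DNE | DBoth.

Definition deco_to (d : deco) : 'I_3 :=
  match d with DNW => inord 0 | DNE => inord 1 | DBoth => inord 2 end.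
Definition deco_of (i : 'I_3) : deco :=
  match val i with 0 => DNW | 1 => DNE | _ => DBoth end.
Lemma deco_toK : cancel deco_to deco_of.
Proof. by case; rewrite /deco_of /= inordK. Qed.
HB.instance Definition _ := Finite.copy deco (can_type deco_toK).

(* ---------- Arrowed monotone triangles with bottom row (1,...,n) ----------
   Rows and positions are 0-based: entry (i,j), 0 <= j <= i < n, is m_{i+1,j+1}.
   Positions with j > i are unused and fixed to a dummy value.  Entries are
   stored in 'I_n.+1 (this loses nothing: interlacing with the bottom row
   (1,...,n) forces all entries into [1,n]). *)
Definition amt (n : nat) := {ffun 'I_n * 'I_n -> 'I_n.+1 * deco}.

Section AMT.
Variable n : nat.
Implicit Type A : amt n.

Definition ent A (i j : 'I_n) : nat := val (A (i, j)).1.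
Definition dec A (i j : 'I_n) : deco := (A (i, j)).2.

Definition is_amt A : bool :=
  [&&
      [forall i : 'I_n, forall j : 'I_n, (i < j)%N ==> (A (i, j) == (ord0, DNW))],
      [forall i : 'I_n, forall i' : 'I_n, forall j : 'I_n, forall j' : 'I_n,
         [&& val i' == i.+1, val j' == j.+1 & (j <= i)%N] ==>
         ((ent A i' j <= ent A i j) && (ent A i j <= ent A i' j'))%N],
      [forall i : 'I_n, forall j : 'I_n, forall j' : 'I_n,
         ((val j' == j.+1) && (j' <= i)%N) ==> (ent A i j < ent A i j')%N],
      [forall i : 'I_n, forall j : 'I_n, (i.+1 == n) ==> (ent A i j == j.+1)],
      (* equal to northwest neighbour  ==>  decoration ↗ *)
      [forall i : 'I_n, forall i' : 'I_n, forall j : 'I_n, forall j' : 'I_n,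
         [&& val i' == i.+1, val j' == j.+1, (j <= i)%N & ent A i' j' == ent A i j]
         ==> (dec A i' j' == DNE)]
    & (* equal to northeast neighbour  ==>  decoration ↖ *)
      [forall i : 'I_n, forall i' : 'I_n, forall j : 'I_n,
         [&& val i' == i.+1, (j <= i)%N & ent A i' j == ent A i j]
         ==> (dec A i' j == DNW)]].

Definition rowsum A (k : nat) : nat :=
  \sum_(p : 'I_n * 'I_n | (val p.1 == k) && (p.2 <= p.1)%N) ent A p.1 p.2.
Definition prevsum A (k : nat) : nat := if k is k'.+1 then rowsum A k' else 0.
Definition cnt_row A (d : deco) (i : 'I_n) : nat :=
  #|[set j : 'I_n | (j <= i)%N && (dec A i j == d)]|.
Definition cnt A (d : deco) : nat := \sum_(i : 'I_n) cnt_row A d i.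

Definition amt_xexp A (i : 'I_n) : int :=
  (rowsum A i)%:Z - (prevsum A i)%:Z + (cnt_row A DNE i)%:Z - (cnt_row A DNW i)%:Z.

Local Open Scope ring_scope.
Definition amt_weight (R : comUnitRingType) (u v w : R) (X : 'I_n -> R) A : R :=
  u ^+ cnt A DNE * v ^+ cnt A DNW * w ^+ cnt A DBoth *
  \prod_(i : 'I_n) X i ^ amt_xexp A i.
End AMT.

(* ---------- Set-valued near-balanced column strict plane partitions ----------
   A filling is a map from cells (r,c) (0-based, English notation, row r going
   down, column c going right) to subsets of 'I_n (element k stands for k+1);
   the shape is the set of cells with nonempty content.  The box n x (n+1)
   contains every such shape: column strictness gives <= n cells per column,
   hence b_1 <= n-1 and a_1 <= b_1+1 <= n, i.e. lambda_1 <= n+1. *)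
Definition sbcspp (n : nat) := {ffun 'I_n * 'I_n.+1 -> {set 'I_n}}.

Section SBCSPP.
Variable n : nat.
Implicit Type D : sbcspp n.

Definition inshape D (p : 'I_n * 'I_n.+1) : bool := D p != set0.
Definition diagc (i : 'I_n) : 'I_n.+1 := widen_ord (leqnSn n) i.
Definition setmax (S : {set 'I_n}) : nat := \max_(k in S) val k.

Definition ondiag D (i : 'I_n) : bool := inshape D (i, diagc i).
Definition frob_l D : nat := #|[set i : 'I_n | ondiag D i]|.
Definition arm D (i : 'I_n) : nat :=
  #|[set c : 'I_n.+1 | (i < c)%N && inshape D (i, c)]|.
Definition leg D (i : 'I_n) : nat :=
  #|[set r : 'I_n | (i < r)%N && inshape D (r, diagc i)]|.

Definition is_sbcspp D : bool :=
  [&&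
      [forall r : 'I_n, forall r' : 'I_n, forall c : 'I_n.+1, forall c' : 'I_n.+1,
         [&& (r' <= r)%N, (c' <= c)%N & inshape D (r, c)] ==> inshape D (r', c')],
      [forall i : 'I_n, ondiag D i ==> ((arm D i == leg D i) || (arm D i == (leg D i).+1))],
      [forall r : 'I_n, forall c : 'I_n.+1,
         ((r < c)%N && inshape D (r, c)) ==> (#|D (r, c)| == 1%N)],
      [forall r : 'I_n, forall c : 'I_n.+1, forall c' : 'I_n.+1,
         [&& val c' == c.+1, inshape D (r, c) & inshape D (r, c')] ==>
         (setmax (D (r, c')) <= setmax (D (r, c)))%N]
    &
      [forall r : 'I_n, forall r' : 'I_n, forall c : 'I_n.+1,
         (val r' == r.+1) ==>
         [forall x in D (r, c), forall y in D (r', c), (y < x)%N]]].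

Definition cells D : nat := #|[set p | inshape D p]|.
Definition cells_above D : nat := #|[set p : 'I_n * 'I_n.+1 | inshape D p && (p.1 < p.2)%N]|.
Definition entries D : nat := \sum_(p : 'I_n * 'I_n.+1) #|D p|.
Definition entries_below D : nat :=
  \sum_(p : 'I_n * 'I_n.+1 | (p.2 <= p.1)%N) #|D p|.
Definition count_k D (k : 'I_n) : nat := #|[set p | k \in D p]|.

Local Open Scope ring_scope.
Definition shape_wexp D : int :=
  (frob_l D)%:Z + \sum_(i : 'I_n | ondiag D i) ((leg D i)%:Z - (arm D i)%:Z).

Definition sbcspp_weight (R : comUnitRingType) (u v w : R) (X : 'I_n -> R) D : R :=
  w ^ shape_wexp D * u ^+ cells_above D *
  v ^ (('C(n.+1, 2))%:Z - (entries_below D)%:Z) *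
  w ^ ((entries D)%:Z - (cells D)%:Z) *
  \prod_(k : 'I_n) X k ^+ count_k D k.
End SBCSPP.

(* Main.v *)
Require Import Defs.
From mathcomp Require Import all_boot all_order all_algebra fingroup perm.
From mathcomp Require Import fraction mpoly.
From mathcomp Require Import ring lra zify.
Set Implicit Arguments. Unset Strict Implicit. Unset Printing Implicit Defensive.
Import Order.TTheory GRing.Theory Num.Theory.
Local Open Scope ring_scope.

(* Put f(x) = u x and g(x) = - w - v / x.  Times the Vandermonde product, both sides
   equal prod_i X_i^n * det (f(X_i)^j - g(X_i)^j)_(1 <= j <= n).

   Arrowed monotone triangles.  Times the Vandermonde product, the triangles with
   bottom row k have generating function
     prod_i X_i^-1 * sum_s sgn s prod_(i <= j) (v + w X_(s i) + u X_(s i) X_(s j)) prod_i X_(s i)^(k_i),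
   proved row by row as in the coordinate Bethe ansatz.  For k = (1, ..., n) the
   summand is a symmetric monomial times prod_(i <= j) (f(X_(s j)) - g(X_(s i))), and
   for any f_i, g_i the antisymmetrizer of prod_(i <= j) (f_j - g_i) is
   det (f_i^j - g_i^j).

   Set-valued fillings.  Peeling off the smallest value shows that the fillings of a
   shape lambda have a generating function given by a bialternant with one column for
   each row of lambda.  Summing over near-balanced lambda merges these determinants
   into a single one, whose c-th column (c = 0, ..., n - 1) is (T_(c+1) + w T_c) (X_i)
   up to the factor (-1)^c X_i^n, where T_j = f^j - g^j; column operations
   remove the terms w T_c.

   Everything is computed over a field with generic u, v, w, X_i and then specialized. *)

(** * Antisymmetrizers and determinants *)

(** The two models meet because v + w a + u a b = a (f(b) - g(a)). In a triangle, summing over the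
    three decorations of an entry produces this quadratic. In a filling, a part that ends before the
    diagonal carries a power of v + w x = - x g(x), and one that crosses it a power of u. A
    near-balanced shape is a nest of hooks whose arm exceeds the leg by 0 (factor w) or by 1; these
    two options and the missing hook add up to T_(c+1) + w T_c because - g^(c+1) - w g^c = (v / x)
    g^c. The obstacle is division: geometric sums, telescoping and the cancellation of the
    Vandermonde product need u, v, w, X_i, v + w X_i and X_i - X_j invertible, while the theorem
    allows any u and any units. Hence the detour through the fraction field of an integer polynomial
    ring, where all of these are nonzero. *)

Lemma lift_perm_inj2 n (i0 i1 j0 j1 : 'I_n.+1) (s t : 'S_n) :
  lift_perm i0 j0 s = lift_perm i1 j1 t -> i0 = i1 \/ j0 = j1 ->
  [/\ i0 = i1, j0 = j1 & s = t].
Proof.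
move=> E.
have Eij : (i0 = i1) -> j0 = j1.
  by move=> Ei; move: (lift_perm_id i0 j0 s); rewrite E Ei lift_perm_id.
have Eji : (j0 = j1) -> i0 = i1.
  move=> Ej; apply: (@perm_inj _ (lift_perm i0 j0 s)).
  by rewrite lift_perm_id E lift_perm_id.
move=> H; have [Ei Ej] : i0 = i1 /\ j0 = j1 by case: H => H; split; auto.
split=> //; apply/permP=> k; apply: (@lift_inj _ j0).
by rewrite -(lift_perm_lift i0) E Ei Ej lift_perm_lift.
Qed.

Lemma sum_perm_lift_target (V : nmodType) n (i0 : 'I_n.+1) (G : 'S_n.+1 -> V) :
  \sum_s G s = \sum_k \sum_t G (lift_perm i0 k t).
Proof.
rewrite pair_big /= (reindex (fun p : 'I_n.+1 * 'S_n => lift_perm i0 p.1 p.2)) //=.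
apply: onW_bij; apply: inj_card_bij.
  by case=> [j s] [j' t] /= /lift_perm_inj2 [|_ -> ->]; first by left.
by rewrite card_prod !card_Sn card_ord factS.
Qed.

Lemma sum_perm_lift_source (V : nmodType) n (j0 : 'I_n.+1) (G : 'S_n.+1 -> V) :
  \sum_s G s = \sum_k \sum_t G (lift_perm k j0 t).
Proof.
rewrite pair_big /= (reindex (fun p : 'I_n.+1 * 'S_n => lift_perm p.1 j0 p.2)) //=.
apply: onW_bij; apply: inj_card_bij.
  by case=> [j s] [j' t] /= /lift_perm_inj2 [|-> _ ->]; first by right.
by rewrite card_prod !card_Sn card_ord factS.
Qed.

Lemma horner_diff (F : comNzRingType) (q : {poly F}) n (a b : F) : (size q <= n.+2)%N ->
  q.[a] - q.[b] = \sum_(m < n.+1) q`_m.+1 * (a ^+ m.+1 - b ^+ m.+1).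
Proof.
move=> sq; rewrite !(horner_coef_wide _ sq) -sumrB big_ord_recl /= !expr0 subrr add0r.
by apply: eq_bigr => i _; rewrite mulrBr.
Qed.

Definition powdiff_mx (F : comNzRingType) n (f g : 'I_n -> F) : 'M[F]_n :=
  \matrix_(i, j) (f i ^+ j.+1 - g i ^+ j.+1).

(* With [q] the monic polynomial vanishing at all [f j], the factor
   [\prod_j (f j - g k)] is [q.[g k] - q.[f k]] up to sign; this difference has no
   constant term, so it is a combination of the columns of [powdiff_mx f g]. *)
Lemma det_powdiff_rec (F : comNzRingType) n (f g : 'I_n.+1 -> F) :
  \det (powdiff_mx f g) =
  \sum_(k < n.+1) (-1) ^+ k * (\prod_j (f j - g k)) *
     \det (powdiff_mx (f \o lift k) (g \o lift k)).
Proof.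
pose q : {poly F} := \prod_(j < n.+1) ('X - (f j)%:P).
have sq : size q = n.+2 by rewrite /q -big_enum size_prod_XsubC size_enum_ord.
have qf i : q.[f i] = 0 by rewrite horner_prod (bigD1 i) //= hornerXsubC subrr mul0r.
have qg k : \prod_j (f j - g k) = (-1) ^+ n.+1 * q.[g k].
  rewrite horner_prod -[in (-1) ^+ _](card_ord n.+1) -prodrN.
  by apply: eq_bigr => j _; rewrite hornerXsubC opprB.
(* [C] performs column operations: its column 0 holds the coefficients of [- q] beyond the constant
   one, and its column j + 1 selects column j. The last column of [powdiff_mx f g] is thus the one
   replaced, and its coefficient - 1 (as [q] is monic) fixes [\det C]. *)
pose C : 'M[F]_n.+1 := \matrix_(m, j)
  (if unlift ord0 j is Some j' then (m == j' :> nat)%:R else - q`_m.+1).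
pose B : 'M[F]_n.+1 := \matrix_(i, j)
  (if unlift ord0 j is Some j' then f i ^+ j'.+1 - g i ^+ j'.+1 else q.[g i]).
have AC : powdiff_mx f g *m C = B.
  apply/matrixP=> i j; rewrite !mxE; under eq_bigr do rewrite !mxE.
  case: unliftP => [j' _|_].
    rewrite (bigD1 (widen_ord (leqnSn n) j')) //= eqxx mulr1 big1 ?addr0 // => m.
    by rewrite -val_eqE /= => /negbTE ->; rewrite mulr0.
  have -> : q.[g i] = - (q.[f i] - q.[g i]) by rewrite qf sub0r opprK.
  rewrite (@horner_diff _ q n) ?sq // -sumrN.
  by apply: eq_bigr => m _; rewrite mulrN mulrC.
have detC : \det C = (-1) ^+ n.+1.
  rewrite (expand_det_row _ ord_max) (bigD1 ord0) //= big1 ?addr0 => [|j].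
    rewrite mxE unlift_none /cofactor /= addn0.
    have -> : row' ord_max (col' ord0 C) = 1%:M.
      by apply/matrixP=> i j; rewrite !mxE liftK lift_max.
    rewrite det1 mulr1.
    have /monicP : q \is monic by apply: monic_prod_XsubC.
    by rewrite lead_coefE sq /= => ->; rewrite exprS.
  case: (unliftP ord0 j) => [j' ->|->]; last by rewrite eqxx.
  by rewrite mxE liftK /= gtn_eqF ?mul0r.
have := congr1 determinant AC; rewrite det_mulmx detC => detB.
have -> : \det (powdiff_mx f g) = \det B * (-1) ^+ n.+1.
  by rewrite -detB -mulrA -expr2 sqrr_sign mulr1.
rewrite (expand_det_col _ ord0) big_distrl /=; apply: eq_bigr => k _.
rewrite mxE unlift_none qg /cofactor /= addn0.
have -> : row' k (col' ord0 B) = powdiff_mx (f \o lift k) (g \o lift k).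
  by apply/matrixP=> i j; rewrite !mxE liftK.
by ring.
Qed.

(** The factors with i = 0 run over all j, so their product sees the permutation only through k =
    [s ord0]; the other factors form the antisymmetrizer of the remaining variables. This is the
    recurrence [det_powdiff_rec]. *)
Lemma asym_det (F : comNzRingType) n (f g : 'I_n -> F) :
  \sum_(s : 'S_n) (-1) ^+ s * \prod_(i < n) \prod_(j < n | (i <= j)%N) (f (s j) - g (s i))
  = \det (powdiff_mx f g).
Proof.
elim: n f g => [|n IH] f g.
  rewrite det_mx00 (big_pred1 1%g) => [|s]; last by apply/esym/eqP/permP; case.
  by rewrite odd_perm1 big_ord0 mulr1.
rewrite det_powdiff_rec (sum_perm_lift_target ord0); apply: eq_bigr => k _.
rewrite -IH big_distrr /=; apply: eq_bigr => t _.
rewrite odd_lift_perm /= signr_addb signr_odd big_ord_recl /=.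
rewrite [RHS]mulrACA; congr (_ * (_ * _)).
  rewrite lift_perm_id [RHS](reindex_inj (@perm_inj _ (lift_perm ord0 k t))) /=.
  by apply: eq_bigl.
apply: eq_bigr => i _; rewrite big_mkcond big_ord_recl /= mul1r -big_mkcond /=.
by apply: eq_big => [j|j _]; rewrite ?lift0 //= !lift_perm_lift.
Qed.

(** * Adding a row to an arrowed monotone triangle *)

Lemma deco_ofK : cancel deco_of deco_to.
Proof.
by case=> [[|[|[|//]]] lti]; apply: val_inj; rewrite /deco_of /= inordK.
Qed.

Lemma sum_deco (V : nmodType) (G : deco -> V) :
  \sum_d G d = G DNW + G DNE + G DBoth.
Proof.
rewrite (reindex deco_of) /=; last first.
  by apply: onW_bij; exists deco_to; [apply: deco_ofK | apply: deco_toK].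
by rewrite !big_ord_recr big_ord0 /= add0r.
Qed.

Lemma sum_ffun_forall (F : comPzSemiRingType) (I J : finType) (Q : I -> pred J) (G : I -> J -> F) :
  \sum_(f : {ffun I -> J} | [forall i, Q i (f i)]) \prod_i G i (f i)
  = \prod_i \sum_(j | Q i j) G i j.
Proof.
under [RHS]eq_bigr do rewrite big_mkcond.
rewrite bigA_distr_bigA big_mkcond; apply: eq_bigr => f _.
case: ifP => [/forallP Qf | /negbT/forallPn [i /negbTE Qi]].
  by apply: eq_bigr => i _; rewrite Qf.
by rewrite (bigD1 i) //= Qi mul0r.
Qed.

Lemma prod_ord_lift (F : comPzSemiRingType) r (h : 'I_r.+1) (G : 'I_r -> F) :
  \prod_(b < r.+1) (if unlift h b is Some j then G j else 1) = \prod_j G j.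
Proof.
rewrite (bigD1_ord h) //= unlift_none mul1r.
by apply: eq_bigr => j _; rewrite liftK.
Qed.

Section Bethe.
Variables (F : fieldType) (u v w : F).

(** The scattering factor, equal to a (u b - (- w - v / a)). On the diagonal, [scat y y / y] is the
    total weight u y + w + v / y of the three decorations. *)
Definition scat (a b : F) := v + w * a + u * a * b.
Definition dwt (y : F) (d : deco) : F :=
  match d with DNE => u * y | DNW => v / y | DBoth => w end.
(** An entry k decorated by d has its northeast-neighbour at least k + [dlo d] and its
    northwest-neighbour below k + [dup d], since only [DNW], resp. [DNE], permits equality. Once the
    decorations of a row are fixed, the entries above it therefore range independently over
    intervals. *)
Definition dlo (d : deco) : nat := if d is DNW then 0 else 1.
Definition dup (d : deco) : nat := if d is DNE then 1 else 0.

Definition scat_prod r (z : 'I_r -> F) : F :=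
  \prod_(i < r) \prod_(j < r | (i <= j)%N) scat (z i) (z j).

Definition bethe r (x : 'I_r -> F) (k : 'I_r -> nat) : F :=
  \sum_(s : 'S_r) (-1) ^+ s *
     (scat_prod (x \o s) * \prod_i x (s i) ^+ k i).

Definition extend r (x : 'I_r -> F) (y : F) (i : 'I_r.+1) : F :=
  if unlift ord_max i is Some j then x j else y.

(** The case a = b does occur: two consecutive integers whose decorations forbid both equalities
    leave an empty interval. *)
Lemma interval_sum N (a b : nat) (y z : F) : y != 0 -> (a <= b <= N)%N ->
  (y - z) * \sum_(m < N | (a <= m < b)%N) (y ^- m * z ^+ m)
  = y * ((z / y) ^+ a - (z / y) ^+ b).
Proof.
move=> y0 /andP[ab bN].
have -> : \sum_(m < N | (a <= m < b)%N) (y ^- m * z ^+ m) = \sum_(a <= m < b) (z / y) ^+ m.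
  rewrite (big_nat_widen _ _ _ _ _ bN) big_geq_mkord; apply: eq_big => [m|m _] /=.
    by rewrite andbC.
  by rewrite expr_div_n mulrC.
have -> : (y - z) = y * (1 - z / y) by field.
rewrite -mulrA; congr (_ * _); rewrite big_distrr /=.
rewrite -[RHS]opprB -(telescope_sumr _ ab) -sumrN; apply: eq_bigr => m _.
by rewrite exprS; ring.
Qed.

Section Step.
Variables (r : nat) (y : F) (k : nat -> nat).
Hypothesis y0 : y != 0.

(* Summing over an entry [m_j] between the consecutive entries [k_j], [k_(j+1)] of
   the row below gives a geometric sum, i.e. a left-end term minus a right-end term.
   [c j] tells that the right-end term is chosen for interval [j]; [bfac] collects
   what the choices around the entry [k_b] contribute. *)
Definition bfac (c : 'I_r -> bool) (z : 'I_r -> F) (b : 'I_r.+1) (e : deco) : F :=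
  (if unlift ord_max b is Some j then (if c j then 1 else (z j / y) ^+ (k b + dlo e)) else 1) *
  (if unlift ord0 b is Some j then (if c j then - (z j / y) ^+ (k b + dup e) else 1) else 1).

Definition bwt (c : 'I_r -> bool) (z : 'I_r -> F) (b : 'I_r.+1) : F :=
  \sum_e dwt y e * y ^+ k b * bfac c z b e.

(** The product of differences is expanded over the choices [c] and regrouped by entries: interval j
    touches entry j ([lift ord_max j]) with its left end and entry j + 1 ([lift ord0 j]) with its
    right end. For fixed [c] each decoration then occurs in a single factor, so the sum over
    decorations factorizes. *)
Lemma sum_deco_intervals (z : 'I_r -> F) :
  \sum_(d : {ffun 'I_r.+1 -> deco}) (\prod_b (dwt y (d b) * y ^+ k b)) *
     \prod_j ((z j / y) ^+ (k j + dlo (d (lift ord_max j)))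
              - (z j / y) ^+ (k j.+1 + dup (d (lift ord0 j))))
  = \sum_(c : {ffun 'I_r -> bool}) \prod_b bwt c z b.
Proof.
under [RHS]eq_bigr do rewrite /bwt bigA_distr_bigA /=.
rewrite exchange_big /=; apply: eq_bigr => d _.
pose G j (c : bool) := if c then - (z j / y) ^+ (k j.+1 + dup (d (lift ord0 j)))
                       else (z j / y) ^+ (k j + dlo (d (lift ord_max j))).
transitivity ((\prod_b (dwt y (d b) * y ^+ k b)) * \prod_j \sum_c G j c).
  by congr (_ * _); apply: eq_bigr => j _; rewrite big_bool /= addrC.
rewrite bigA_distr_bigA big_distrr /=; apply: eq_bigr => c _.
rewrite [RHS]big_split /=; congr (_ * _).
pose GL j := if c j then 1 else (z j / y) ^+ (k j + dlo (d (lift ord_max j))).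
pose GR j := if c j then - (z j / y) ^+ (k j.+1 + dup (d (lift ord0 j))) else 1.
rewrite (_ : \prod_j G j (c j) = (\prod_j GL j) * \prod_j GR j); last first.
  rewrite -big_split /=; apply: eq_bigr => j _; rewrite /G /GL /GR.
  by case: (c j); rewrite ?mul1r ?mulr1.
rewrite -(prod_ord_lift ord_max) -(prod_ord_lift ord0 GR) -big_split /=.
apply: eq_bigr => b _; rewrite /bfac; congr (_ * _).
  by case: unliftP => [j ->|//]; rewrite /GL lift_max.
by case: unliftP => [j ->|//]; rewrite /GR lift0.
Qed.


(** An entry is selected by neither, one or both of its adjacent intervals. In each of the four
    cases the shifts [dlo] and [dup] make the sum over its decorations a single value of [scat],
    divided by y. *)
Lemma bwt_none (c : 'I_r -> bool) (z : 'I_r -> F) (b : 'I_r.+1) :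
  (if unlift ord_max b is Some j then c j else true) ->
  (if unlift ord0 b is Some j then ~~ c j else true) ->
  bwt c z b = y ^+ k b * (scat y y / y).
Proof.
move=> HR HL; rewrite /bwt sum_deco /bfac.
have E e : (if unlift ord_max b is Some j then (if c j then 1 else (z j / y) ^+ (k b + dlo e)) else 1) = 1.
  by case: (unlift ord_max b) HR => [j ->|].
have E' e : (if unlift ord0 b is Some j then (if c j then - (z j / y) ^+ (k b + dup e) else 1) else 1) = 1.
  by case: (unlift ord0 b) HL => [j /negbTE ->|].
by rewrite !E !E' /scat /=; field.
Qed.

Lemma bwt_right (c : 'I_r -> bool) (z : 'I_r -> F) (b : 'I_r.+1) (j : 'I_r) : unlift ord_max b = Some j -> ~~ c j ->
  (if unlift ord0 b is Some j then ~~ c j else true) ->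
  bwt c z b = z j ^+ k b * (scat (z j) y / y).
Proof.
move=> Eb cj HL; rewrite /bwt sum_deco /bfac Eb (negbTE cj).
have E' e : (if unlift ord0 b is Some j then (if c j then - (z j / y) ^+ (k b + dup e) else 1) else 1) = 1.
  by case: (unlift ord0 b) HL => [i /negbTE ->|].
have Y : y ^+ k b != 0 by apply: expf_neq0.
by rewrite !E' /scat /= ?addn0 ?addn1 !exprS !expr_div_n; field; rewrite Y y0.
Qed.

Lemma bwt_left (c : 'I_r -> bool) (z : 'I_r -> F) (b : 'I_r.+1) (j : 'I_r) : unlift ord0 b = Some j -> c j ->
  (if unlift ord_max b is Some j then c j else true) ->
  bwt c z b = - (z j ^+ k b * (scat y (z j) / y)).
Proof.
move=> Eb cj HR; rewrite /bwt sum_deco /bfac Eb cj.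
have E e : (if unlift ord_max b is Some j then (if c j then 1 else (z j / y) ^+ (k b + dlo e)) else 1) = 1.
  by case: (unlift ord_max b) HR => [i ->|].
have Y : y ^+ k b != 0 by apply: expf_neq0.
by rewrite !E /scat /= ?addn0 ?addn1 !exprS !expr_div_n; field; rewrite Y y0.
Qed.

Lemma bwt_both (c : 'I_r -> bool) (z : 'I_r -> F) (b : 'I_r.+1) (i j : 'I_r) : unlift ord0 b = Some i -> c i ->
  unlift ord_max b = Some j -> ~~ c j ->
  bwt c z b = - (y ^- k b * (z i * z j) ^+ k b * (scat (z j) (z i) / y)).
Proof.
move=> Ei ci Ej cj; rewrite /bwt sum_deco /bfac Ei Ej ci (negbTE cj).
have Y : y ^+ k b != 0 by apply: expf_neq0.
by rewrite /scat /= ?addn0 ?addn1 !exprS !expr_div_n !exprMn; field; rewrite Y y0.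
Qed.

(** Intervals before p select their left end, the others their right end, so entry p is the only one
    not selected: it keeps the new variable y, while the old variables fill the other entries in
    order. The sign counts the r - p right ends. *)
Lemma prod_bwt_mono (p : 'I_r.+1) (z : 'I_r -> F) :
  \prod_b bwt (fun j => (p <= j)%N) z b =
  (-1) ^+ (p + r) * y ^- r.+1 *
  (scat y y * \prod_(j < r) (if (j < p)%N then scat (z j) y else scat y (z j))) *
  (y ^+ k p * \prod_(j < r) z j ^+ k (lift p j)).
Proof.
have sgn : \prod_(j < r) (if (j < p)%N then 1 else -1 : F) = (-1) ^+ (p + r).
  have : (p <= r)%N by rewrite -ltnS.
  elim: r (nat_of_ord p) => [|n IH] q; first by case: q => //; rewrite big_ord0.
  rewrite leq_eqVlt => /orP[/eqP->|qn].
    rewrite big1 => [|j _]; last by rewrite ltn_ord.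
    by rewrite addnn -signr_odd odd_double.
  have {}qn : (q <= n)%N by [].
  by rewrite big_ord_recr /= IH // ltnNge qn /= addnS exprS mulrC.
rewrite (bigD1_ord p) //= bwt_none; first last.
- by case: unliftP => [j ->|//]; rewrite lift0 -ltnNge.
- by case: unliftP => [j ->|//]; rewrite lift_max.
have -> : \prod_(j < r) bwt (fun j => (p <= j)%N) z (lift p j) =
    \prod_(j < r) ((if (j < p)%N then 1 else -1) * (y^-1 *
      ((if (j < p)%N then scat (z j) y else scat y (z j)) * z j ^+ k (lift p j)))).
  apply: eq_bigr => j _.
  case: ltnP => [jp|pj].
    have E : lift p j = lift ord_max j.
      by apply: val_inj; rewrite /= /bump [(p <= j)%N]leqNgt jp [(r <= j)%N]leqNgt ltn_ord.
    rewrite (@bwt_right _ _ _ j) ?E ?liftK -?ltnNge //.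
      by move: (z j ^+ _) (scat _ _) => K T; ring.
    case: unliftP => [i Ei|//]; move: (congr1 (@nat_of_ord _) Ei).
    by rewrite lift_max lift0 -ltnNge => Ej; rewrite ltnW // -Ej.
  have E : lift p j = lift ord0 j.
    by apply: val_inj; rewrite /= /bump pj.
  rewrite (@bwt_left _ _ _ j) ?E ?liftK //.
    by move: (z j ^+ _) (scat _ _) => K T; ring.
  case: unliftP => [i Ei|//]; move: (congr1 (@nat_of_ord _) Ei).
  rewrite lift_max lift0 => <-.
  by rewrite leqW.
rewrite big_split /= sgn big_split /= prodr_const card_ord big_split /= exprVn exprS.
by rewrite invfM; ring.
Qed.

Lemma scat_prod_lift (p : 'I_r.+1) (x : 'I_r -> F) (s : 'S_r) :
  scat_prod (extend x y \o lift_perm p ord_max s) =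
  scat_prod (x \o s) *
  (scat y y * \prod_(j < r) (if (j < p)%N then scat (x (s j)) y else scat y (x (s j)))).
Proof.
have Ep : (extend x y \o lift_perm p ord_max s) p = y.
  by rewrite /= lift_perm_id /extend unlift_none.
have El j : (extend x y \o lift_perm p ord_max s) (lift p j) = x (s j).
  by rewrite /= lift_perm_lift /extend liftK.
rewrite /scat_prod; set Z := (_ \o lift_perm _ _ _) in Ep El *.
rewrite (bigD1_ord p) //= (bigD1_ord p) //= Ep.
have -> : \prod_(i < r) \prod_(j < r.+1 | (lift p i <= j)%N) scat (Z (lift p i)) (Z j)
  = (\prod_(i < r) if (i < p)%N then scat (x (s i)) y else 1) *
    \prod_(i < r) \prod_(j < r | (i <= j)%N) scat (x (s i)) (x (s j)).
  rewrite -big_split; apply: eq_bigr => i _ /=.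
  rewrite big_mkcond (bigD1_ord p) //= Ep El -big_mkcond /=; congr (_ * _).
    by rewrite /bump; case: leqP => ip; [rewrite add1n ltnNge ip | rewrite add0n ltnW].
  by apply: eq_big => [j|j _]; rewrite ?leq_bump2 ?El.
have -> : \prod_(i < r | (p <= lift p i)%N) scat y (Z (lift p i)) =
   \prod_(i < r) if (i < p)%N then 1 else scat y (x (s i)).
  rewrite big_mkcond; apply: eq_bigr => i _ /=; rewrite El /bump.
  by case: (leqP p i) => ip; [rewrite add1n leqW | rewrite add0n leqNgt ip].
have -> : \prod_(j < r) (if (j < p)%N then scat (x (s j)) y else scat y (x (s j))) =
  (\prod_(i < r) if (i < p)%N then scat (x (s i)) y else 1) *
  \prod_(i < r) if (i < p)%N then 1 else scat y (x (s i)).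
  rewrite -big_split; apply: eq_bigr => i _ /=.
  by case: ifP; rewrite ?mulr1 ?mul1r.
by rewrite /=; ring.
Qed.

End Step.
End Bethe.

Lemma asym_sym0 (F : pzRingType) r (a b : 'I_r) (G : 'S_r -> F) : a != b ->
  (forall s, G (tperm a b * s)%g = G s) -> \sum_(s : 'S_r) (-1) ^+ s * G s = 0.
Proof.
move=> ab Gt; rewrite (bigID (@odd_perm _)) /= [X in _ + X](reindex_inj (mulgI (tperm a b))) /=.
have odd_t (s : 'S_r) : odd_perm (tperm a b * s)%g = ~~ odd_perm s.
  by rewrite odd_permM odd_tperm ab addTb.
rewrite -[X in _ + X]opprK -sumrN.
under [X in _ - X]eq_bigl => s do rewrite odd_t negbK.
rewrite [X in _ - X](eq_bigr (fun s : 'S_r => (-1) ^+ s * G s)) ?subrr // => s os.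
by rewrite Gt odd_t os expr0 expr1 mul1r mulN1r.
Qed.

(** A choice in which true is never followed by false is determined by the least index where it is
    true, with r standing for none. *)
Lemma sum_mono_bool (V : nmodType) r (G : {ffun 'I_r -> bool} -> V) :
  (forall (c : {ffun 'I_r -> bool}) (a b : 'I_r), b = a.+1 :> nat -> c a -> ~~ c b -> G c = 0) ->
  \sum_c G c = \sum_(p < r.+1) G [ffun j : 'I_r => (p <= j)%N].
Proof.
move=> G0; pose cp (p : 'I_r.+1) : {ffun 'I_r -> bool} := [ffun j : 'I_r => (p <= j)%N].
have cp_inj : injective cp.
  have le (p q : 'I_r.+1) : cp p = cp q -> (p <= q)%N.
    move=> E; rewrite leqNgt; apply/negP => qp.
    have qr : (q < r)%N by rewrite (leq_trans qp) // -ltnS.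
    by move/ffunP/(_ (Ordinal qr)): E; rewrite !ffunE /= leqnn leqNgt qp.
  by move=> p q E; apply/val_inj/anti_leq; rewrite !le.
rewrite (bigID (fun c => c \in cp @: [set: 'I_r.+1])) /= big_imset /=; last by move=> p q _ _; apply: cp_inj.
rewrite [X in _ + X]big1 ?addr0 => [|c]; first by apply: eq_bigl => p; rewrite inE.
move=> nc; case: (boolP [exists a : 'I_r, exists b : 'I_r, [&& b == a.+1 :> nat, c a & ~~ c b]]).
  by case/existsP=> a /existsP[b /and3P[/eqP E ca cb]]; exact: (G0 c a b).
move=> /existsPn mono; case/negP: nc.
pose P i := (i == r) || [exists j : 'I_r, (j == i :> nat) && c j].
have exP : exists i, P i by exists r; rewrite /P eqxx.
case: (ex_minnP exP) => p Pp minp.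
have pr : (p < r.+1)%N by rewrite ltnS minp // /P eqxx.
have at_p i (ir : (i < r)%N) : p == i -> c (Ordinal ir).
  move=> /eqP Ep; move: Pp; rewrite /P Ep => /orP[/eqP E|/existsP[j /andP[/eqP jE cj]]].
    by exfalso; move: ir; rewrite E ltnn.
  by rewrite (_ : Ordinal ir = j) //; apply: val_inj.
have up i (ir : (i < r)%N) : (p <= i)%N -> c (Ordinal ir).
  elim: i ir => [|i IH] ir; first by rewrite leqn0; apply: at_p.
  rewrite leq_eqVlt => /orP[|]; first exact: at_p.
  rewrite ltnS => pi; have ir' := ltnW ir.
  move: (mono (Ordinal ir')) => /existsPn /(_ (Ordinal ir)) /=.
  by rewrite eqxx (IH ir' pi) /= negbK.
apply/imsetP; exists (Ordinal pr); first by rewrite inE.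
apply/ffunP=> j; rewrite ffunE /=.
case: leqP => [pj|jp].
  by have := up j (ltn_ord j) pj; rewrite (_ : Ordinal _ = j) //; apply: val_inj.
apply/negbTE/negP => cj; move: jp; rewrite ltnNge minp // /P.
by apply/orP; right; apply/existsP; exists j; rewrite eqxx.
Qed.

(** * Cancellation under antisymmetrization and the row recursion *)

Section Bethe.
Variables (F : fieldType) (u v w : F).
Local Notation scat := (scat u v w).
Local Notation scat_prod := (scat_prod u v w).

(* If interval [a] picks its right end and interval [a.+1] its left end, the entry
   between them contributes [scat (z b) (z a)]; together with the factor
   [scat (z a) (z b)] of [scat_prod] the summand is symmetric in [z a], [z b], so the
   antisymmetrization kills it. *)
Lemma scat_prod_swap r (a b : 'I_r) (z : 'I_r -> F) : b = a.+1 :> nat ->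
  exists2 C, scat_prod z = scat (z a) (z b) * C
           & scat_prod (z \o tperm a b) = scat (z b) (z a) * C.
Proof.
move=> ab; pose Ap (z : 'I_r -> F) :=
  \prod_(p : 'I_r * 'I_r | (p.1 <= p.2)%N && (p != (a, b))) scat (z p.1) (z p.2).
have E t : scat_prod t = scat (t a) (t b) * Ap t.
  by rewrite /scat_prod pair_big_dep /= (bigD1 (a, b)) //= ab.
exists (Ap z) => //; rewrite E /= tpermL tpermR; congr (_ * _).
rewrite /Ap (reindex_inj (h := fun p => (tperm a b p.1, tperm a b p.2))) /=; last first.
  by apply: (can_inj (g := fun p => (tperm a b p.1, tperm a b p.2))) => [[i j]] /=; rewrite !tpermK.
apply: eq_big => [[i j]|[i j] _] /=; last by rewrite !tpermK.
have abF : (a == b) = false by apply/eqP => /(congr1 val) /=; rewrite ab; lia.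
have baF : (b == a) = false by rewrite eq_sym.
rewrite !xpair_eqE.
case: (tpermP a b i) => [->|->|/eqP ia /eqP ib]; case: (tpermP a b j) => [->|->|/eqP ja /eqP jb];
  rewrite ?eqxx ?abF ?baF ?(negbTE ia) ?(negbTE ib) ?(negbTE ja) ?(negbTE jb) ?andbF ?andbT ?andTb //=;
  try (rewrite ab; lia).
- by move: ja jb; rewrite -!val_eqE /= ab; lia.
- by move: ja jb; rewrite -!val_eqE /= ab; lia.
- by move: ia ib; rewrite -!val_eqE /= ab; lia.
- by move: ia ib; rewrite -!val_eqE /= ab; lia.
Qed.

(** Both intervals select the entry [B] between them, so [z a] and [z b] occur in no other factor,
    and in that of [B] only [scat] is not symmetric in them. *)
Lemma prod_bwt_swap r (y : F) (k : nat -> nat) (c : 'I_r -> bool) (a b : 'I_r) (z : 'I_r -> F) :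
  y != 0 -> b = a.+1 :> nat -> c a -> ~~ c b ->
  exists2 C, \prod_i bwt u v w y k c z i = scat (z b) (z a) * C
           & \prod_i bwt u v w y k c (z \o tperm a b) i = scat (z a) (z b) * C.
Proof.
move=> y0 ab ca cb; pose B := lift ord0 a.
have EB : B = lift ord_max b by apply: val_inj; rewrite /= /bump [(r <= b)%N]leqNgt ltn_ord ab.
have Eb t : bwt u v w y k c t B = - (y ^- k B * (t a * t b) ^+ k B * (scat (t b) (t a) / y)).
  by apply: bwt_both => //; rewrite ?EB ?liftK // -EB liftK.
exists (- (y ^- k B * (z a * z b) ^+ k B / y) * \prod_(i | i != B) bwt u v w y k c z i).
  by rewrite (bigD1 B) //= Eb; ring.
rewrite (bigD1 B) //= Eb /= tpermL tpermR [z b * z a]mulrC.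
rewrite (eq_bigr (bwt u v w y k c z)); first by ring.
move=> i iB; rewrite /bwt; apply: eq_bigr => e _; congr (_ * _); rewrite /bfac; congr (_ * _).
- case: unliftP => [j Ej|//]; case: ifP => // /negbT cj; rewrite /= tpermD //.
    by apply: contraNneq cj => <-.
  by apply: contraNneq iB => Eq; rewrite Ej -Eq EB.
case: unliftP => [j Ej|//]; case: ifP => // cj; rewrite /= tpermD //.
  by apply: contraNneq iB => Eq; rewrite Ej -Eq.
by apply: contraNneq cb => ->.
Qed.

Lemma asym_bwt0 r (y : F) (k : nat -> nat) (c : 'I_r -> bool) (a b : 'I_r) (x : 'I_r -> F) :
  y != 0 -> b = a.+1 :> nat -> c a -> ~~ c b ->
  \sum_(s : 'S_r) (-1) ^+ s * (scat_prod (x \o s) * \prod_i bwt u v w y k c (x \o s) i) = 0.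
Proof.
move=> y0 ab ca cb; apply: (@asym_sym0 _ _ a b) => [|s].
  by apply/eqP => /(congr1 val) /=; rewrite ab; lia.
have E i : (x \o (tperm a b * s)%g) i = ((x \o s) \o tperm a b) i by rewrite /= permM.
have -> : scat_prod (x \o (tperm a b * s)%g) = scat_prod ((x \o s) \o tperm a b).
  by apply: eq_bigr => i _; apply: eq_bigr => j _; rewrite !E.
have -> : \prod_i bwt u v w y k c (x \o (tperm a b * s)%g) i =
    \prod_i bwt u v w y k c ((x \o s) \o tperm a b) i.
  apply: eq_bigr => i _; apply: eq_bigr => e _; rewrite /bfac.
  by case: unliftP => [j _|_]; case: unliftP => [j' _|_]; rewrite ?E.
have [C -> ->] := scat_prod_swap (x \o s) ab.
have [C' -> ->] := prod_bwt_swap k (x \o s) y0 ab ca cb.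
by ring.
Qed.

(** For a fixed permutation the sum over the upper row is a product of geometric sums, whose
    denominators are cleared by the product of the y - x_i. The antisymmetrization leaves only the
    monotone choices of ends. *)
Lemma bethe_step r (x : 'I_r -> F) (y : F) N (k : nat -> nat) :
  y != 0 -> (forall j, (j < r)%N -> (k j < k j.+1 < N)%N) ->
  \prod_i (y - x i) *
  (\sum_(d : {ffun 'I_r.+1 -> deco}) (\prod_b (dwt u v w y (d b) * y ^+ k b)) *
    \sum_(m : {ffun 'I_r -> 'I_N} |
        [forall j : 'I_r, (k j + dlo (d (lift ord_max j)) <= m j < k j.+1 + dup (d (lift ord0 j)))%N])
      (\prod_j y ^- m j) * bethe u v w x (fun j => m j)) =
  y^-1 * bethe u v w (extend x y) (fun b => k b).
Proof.
move=> y0 kN.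
transitivity (y ^+ r * \sum_(s : 'S_r) (-1) ^+ s * (scat_prod (x \o s) *
   \sum_(c : {ffun 'I_r -> bool}) \prod_b bwt u v w y k c (x \o s) b)).
  under [in RHS]eq_bigr => s _ do rewrite -sum_deco_intervals !big_distrr /=.
  rewrite [in RHS]exchange_big [in LHS]big_distrr [in RHS]big_distrr /=; apply: eq_bigr => d _.
  rewrite mulrCA /bethe.
  transitivity ((\prod_b (dwt u v w y (d b) * y ^+ k b)) * \sum_(s : 'S_r) (-1) ^+ s * (scat_prod (x \o s) *
     \prod_j (y * ((x (s j) / y) ^+ (k j + dlo (d (lift ord_max j)))
              - (x (s j) / y) ^+ (k j.+1 + dup (d (lift ord0 j))))))); last first.
    rewrite !big_distrr /=; apply: eq_bigr => s _.
    rewrite [X in _ * (_ * (_ * X)) = _]big_split /= prodr_const card_ord.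
    by rewrite mulrCA [RHS]mulrCA; congr (_ * _); rewrite mulrCA [RHS]mulrCA; congr (_ * _); rewrite mulrCA.
  congr (_ * _); under [X in _ * X = _]eq_bigr do rewrite big_distrr /=.
  rewrite exchange_big big_distrr /=; apply: eq_bigr => s _.
  rewrite (reindex_inj (@perm_inj _ s)) /=.
  under [X in _ * X = _]eq_bigr => m _ do rewrite mulrCA [X in _ * X]mulrCA -big_split /=.
  rewrite -!big_distrr /=.
  rewrite (sum_ffun_forall (fun (j : 'I_r) (e : 'I_N) =>
      (k j + dlo (d (lift ord_max j)) <= e < k j.+1 + dup (d (lift ord0 j)))%N)
    (fun (j : 'I_r) (e : 'I_N) => y ^- e * x (s j) ^+ e)).
  rewrite mulrCA; congr (_ * _); rewrite mulrCA; congr (_ * _).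
  rewrite -big_split; apply: eq_bigr => j _ /=; apply: interval_sum => //.
  have /andP[kj kN1] := kN j (ltn_ord j).
  by case: (d (lift ord_max j)); case: (d (lift ord0 j)); rewrite /= ?addn0 ?addn1; lia.
under eq_bigr => s _ do rewrite !big_distrr /=.
rewrite exchange_big sum_mono_bool /=; last first.
  move=> c a b ab ca cb; exact: (asym_bwt0 k x y0 ab ca cb).
(* The threshold p of a surviving choice is the position at which a permutation of r + 1 indices
   places the new variable. *)
rewrite /bethe (sum_perm_lift_source ord_max) !big_distrr /=; apply: eq_bigr => p _.
rewrite !big_distrr /=; apply: eq_bigr => s _.
rewrite odd_lift_perm scat_prod_lift /= !signr_addb !signr_odd.
have -> : \prod_b bwt u v w y k [ffun j : 'I_r => (p <= j)%N] (x \o s) b =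
  \prod_b bwt u v w y k (fun j => (p <= j)%N) (x \o s) b.
  apply: eq_bigr => b _; apply: eq_bigr => e _; rewrite /bfac.
  by case: unliftP => [j _|_]; case: unliftP => [j' _|_]; rewrite ?ffunE.
rewrite prod_bwt_mono // (bigD1_ord p) //= lift_perm_id {1}/extend unlift_none.
have -> : \prod_(i < r) extend x y (lift_perm p ord_max s (lift p i)) ^+ k (lift p i)
   = \prod_(i < r) x (s i) ^+ k (lift p i).
  by apply: eq_bigr => i _; rewrite lift_perm_lift /extend liftK.
(* One y for each of the r geometric sums, one inverse for each of the r + 1 entries. *)
have <- : y ^+ r * y ^- r.+1 = y^-1.
  by rewrite exprS invfM mulrCA divff ?mulr1 // expf_neq0.
rewrite exprD; move: (y ^- r.+1) (y ^+ r) (y ^+ k p) (scat_prod _) (_ * \prod_(j < r) _).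
move: (\prod_(i < r) _) ((-1) ^+ _) ((-1) ^+ _) ((-1) ^+ _) => a b c d e f g h i.
by ring.
Qed.

End Bethe.

(** * Sums over chains *)

Section FinfunSums.
Variable V : nmodType.

Lemma sum_ffun_recr (T : finType) n (G : {ffun 'I_n.+1 -> T} -> V) :
  \sum_f G f = \sum_(f : {ffun 'I_n -> T}) \sum_t
     G [ffun i => if unlift ord_max i is Some j then f j else t].
Proof.
rewrite pair_big /= (reindex (fun p : {ffun 'I_n -> T} * T =>
  [ffun i => if unlift ord_max i is Some j then p.1 j else p.2])) //=.
exists (fun f : {ffun 'I_n.+1 -> T} => ([ffun j => f (lift ord_max j)], f ord_max)) => [[f t]|f] _ /=.
  by congr (_, _); [apply/ffunP=> j; rewrite !ffunE liftK | rewrite ffunE unlift_none].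
by apply/ffunP=> i; rewrite ffunE; case: unliftP => [j ->|->]; rewrite ?ffunE.
Qed.

Lemma sum_ffun_pair (I A B : finType) (G : {ffun I -> A * B} -> V) :
  \sum_f G f = \sum_(m : {ffun I -> A}) \sum_(d : {ffun I -> B}) G [ffun i => (m i, d i)].
Proof.
rewrite pair_big /= (reindex (fun p : {ffun I -> A} * {ffun I -> B} =>
  [ffun i => (p.1 i, p.2 i)])) //=.
exists (fun f : {ffun I -> A * B} => ([ffun i => (f i).1], [ffun i => (f i).2])) => [[m d]|f] _ /=.
  by congr (_, _); apply/ffunP=> i; rewrite !ffunE.
by apply/ffunP=> i; rewrite !ffunE; case: (f i).
Qed.

Lemma sum_ffun_curry (I J E : finType) (G : {ffun I * J -> E} -> V) :
  \sum_f G f = \sum_(f : {ffun I -> {ffun J -> E}}) G [ffun p => f p.1 p.2].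
Proof.
rewrite (reindex (fun f : {ffun I -> {ffun J -> E}} => [ffun p : I * J => f p.1 p.2])) //=.
exists (fun f : {ffun I * J -> E} => [ffun i => [ffun j => f (i, j)]]) => f _.
  by apply/ffunP=> i; rewrite ffunE; apply/ffunP=> j; rewrite !ffunE.
by apply/ffunP=> [[i j]]; rewrite !ffunE.
Qed.

(** Rows of all lengths must live in one finite type to be the states of a chain; a dummy value
    fills the positions from i on. *)
Definition padf (E : Type) (e0 : E) i n (m : 'I_i -> E) : {ffun 'I_n -> E} :=
  [ffun j : 'I_n => if insub (j : nat) is Some b then m b else e0].

Lemma padf_lt (E : Type) (e0 : E) i n (m : 'I_i -> E) (j : 'I_n) (b : 'I_i) :
  j = b :> nat -> padf e0 n m j = m b.
Proof. by move=> E1; rewrite ffunE E1 (valK b). Qed.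

Lemma padf_ge (E : Type) (e0 : E) i n (m : 'I_i -> E) (j : 'I_n) : (i <= j)%N -> padf e0 n m j = e0.
Proof. by move=> ij; rewrite ffunE insubN // -leqNgt. Qed.

Lemma sum_padf (E : finType) (e0 : E) i n (G : {ffun 'I_n -> E} -> V) : (i <= n)%N ->
  (forall s : {ffun 'I_n -> E}, ~~ [forall j : 'I_n, (i <= j)%N ==> (s j == e0)] -> G s = 0) ->
  \sum_s G s = \sum_(m : {ffun 'I_i -> E}) G (padf e0 n m).
Proof.
move=> le_in G0.
rewrite (bigID (fun s : {ffun _} => [forall j : 'I_n, (i <= j)%N ==> (s j == e0)])) /=.
rewrite [X in _ + X]big1 // addr0.
rewrite (reindex_onto (fun m : {ffun 'I_i -> E} => padf e0 n m)
   (fun s : {ffun 'I_n -> E} => [ffun j : 'I_i => s (widen_ord le_in j)])) /=; last first.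
  move=> s /forallP s0; apply/ffunP=> j; rewrite ffunE; case: insubP => [b _ Eb|].
    by rewrite ffunE; congr (s _); apply: val_inj; rewrite /= Eb.
  by rewrite -leqNgt => ij; apply/esym/eqP; exact: (implyP (s0 j)).
apply: eq_bigl => m; apply/andP; split.
  by apply/forallP=> j; apply/implyP=> ij; rewrite padf_ge.
by apply/eqP/ffunP=> j; rewrite ffunE; apply: padf_lt.
Qed.

End FinfunSums.

Section Chain.
Variables (F : comPzRingType) (T : finType) (t0 : T) (W : nat -> T -> T -> F).

Fixpoint chainv i t : F := if i is i'.+1 then \sum_s chainv i' s * W i' s t else (t == t0)%:R.

(* Row 0 is preceded by the dummy row [t0]. *)
Definition prevf n (f : {ffun 'I_n -> T}) (i : nat) : T :=
  if i is i'.+1 then (if insub i' is Some j then f j else t0) else t0.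

(** Transfer-matrix method; the statement carries a general [g] so that it can absorb the weight of
    the last row in the induction. *)
Lemma chain_sum n (g : T -> F) :
  \sum_(f : {ffun 'I_n -> T}) (\prod_(i < n) W i (prevf f i) (f i)) * g (prevf f n)
  = \sum_t chainv n t * g t.
Proof.
elim: n g => [|n IH] g.
  rewrite (big_pred1 [ffun=> t0]) => [|f]; last by apply/esym/eqP/ffunP; case.
  rewrite big_ord0 (bigD1 t0) //= eqxx big1 ?addr0 // => t /negbTE ->.
  by rewrite mul0r.
rewrite sum_ffun_recr.
pose h (f : {ffun 'I_n -> T}) t : {ffun 'I_n.+1 -> T} :=
  [ffun i => if unlift ord_max i is Some j then f j else t].
have prevh f t i : (i <= n)%N -> prevf (h f t) i = prevf f i.
  case: i => //= i lin; have lin' := leqW lin.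
  rewrite (insubT (fun i => i < n.+1)%N lin') (insubT (fun i => i < n)%N lin) /=.
  rewrite ffunE (_ : Sub _ _ = lift ord_max (Ordinal lin)) ?liftK //.
  by apply: val_inj; rewrite /= /bump leqNgt lin.
transitivity (\sum_(f : {ffun 'I_n -> T}) \sum_t
   (\prod_(i < n) W i (prevf f i) (f i)) * (W n (prevf f n) t * g t)).
  apply: eq_bigr => f _; apply: eq_bigr => t _; rewrite -/(h f t).
  rewrite big_ord_recr /= prevh // -mulrA; congr (_ * (_ * _)).
  - apply: eq_bigr => i _; rewrite prevh 1?ltnW //; congr (W _ _ _).
    rewrite ffunE (_ : widen_ord _ _ = lift ord_max i) ?liftK //.
    by apply: val_inj; rewrite /= /bump leqNgt ltn_ord.
  - by rewrite ffunE unlift_none.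
  congr g; rewrite (insubT (fun i => i < n.+1)%N (ltnSn n)) ffunE (_ : Sub _ _ = ord_max) ?unlift_none //.
rewrite exchange_big /=; apply: eq_bigr => t _; rewrite -(IH (fun s => W n s t)).
by rewrite big_distrl /=; apply: eq_bigr => f _; rewrite mulrA.
Qed.
End Chain.

(** * Arrowed monotone triangles as chains of rows *)

Section AMTChain.
Variables (F : fieldType) (u v w : F) (X : nat -> F) (n : nat).
Local Notation entry := ('I_n.+1 * deco)%type.
Local Notation row := {ffun 'I_n -> entry}.
Local Notation e0 := ((ord0, DNW) : entry).
Local Notation t0 := ([ffun=> e0] : row).

Definition acond (i : nat) (s t : row) : bool :=
  [forall j : 'I_n, (i < j)%N ==> (t j == e0)] &&
  [forall j : 'I_n, forall j' : 'I_n, ((j' == j.+1 :> nat) && (j < i)%N) ==>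
     (((t j).1 + dlo (t j).2 <= (s j).1) && ((s j).1 < (t j').1 + dup (t j').2))%N].

Definition arow_weight (i : nat) (s t : row) : F :=
  (\prod_(j : 'I_n | (j <= i)%N) (dwt u v w (X i) (t j).2 * X i ^+ (t j).1)) *
  \prod_(j : 'I_n | (j < i)%N) X i ^- (s j).1.

Lemma dlo0 d : dlo d = 0%N -> d = DNW. Proof. by case: d. Qed.
Lemma dup1 d : dup d != 0%N -> d = DNE. Proof. by case: d. Qed.
Lemma dup_dlo d : (dup d <= dlo d)%N. Proof. by case: d. Qed.

Lemma prevf_succ (f : {ffun 'I_n -> row}) (i : 'I_n) (i' : nat) : i' = i.+1 -> prevf t0 f i' = f i.
Proof. by move=> ->; rewrite /= (valK i). Qed.

Definition amt_of_rows (f : {ffun 'I_n -> row}) : amt n := [ffun p => f p.1 p.2].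

(** [acond] says nothing about strict increase within a row. It follows from the row below, whose
    entry k with decoration d separates two neighbours: the left one is less than k + [dup d], the
    right one at least k + [dlo d], and [dup d <= dlo d]. In the last row it follows from the
    prescribed values. *)
Lemma is_amt_rows (f : {ffun 'I_n -> row}) : (0 < n)%N ->
  is_amt (amt_of_rows f) =
  [forall i : 'I_n, acond i (prevf t0 f i) (f i)] &&
  [forall j : 'I_n, (prevf t0 f n j).1 == j.+1 :> nat].
Proof.
move=> n0; set A := amt_of_rows f.
have EA i j : A (i, j) = f i j by rewrite ffunE.
have Eent i j : ent A i j = (f i j).1 by rewrite /ent EA.
have Edec i j : dec A i j = (f i j).2 by rewrite /dec EA.
have last_row (i : 'I_n) : i.+1 = n -> prevf t0 f n = f i.
  by move=> Ein; apply: prevf_succ.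
have lastP : (n.-1 < n)%N by rewrite prednK.
pose il := Ordinal lastP.
have Eil : il.+1 = n by rewrite /= prednK.
apply/idP/idP.
  case/and5P=> /forallP h1 /forallP h2 /forallP h3 /forallP h4 /andP[/forallP h5 /forallP h6].
  apply/andP; split.
    apply/forallP=> i; apply/andP; split.
      apply/forallP=> j; apply/implyP=> ij; rewrite -EA.
      by move/forallP/(_ j)/implyP: (h1 i); apply.
    apply/forallP=> j; apply/forallP=> j'; apply/implyP=> /andP[/eqP jj' ji].
    have [ip Eip] : exists ip : 'I_n, i = ip.+1 :> nat.
      have ip_lt : (i.-1 < n)%N by rewrite (leq_ltn_trans (leq_pred _)).
      by exists (Ordinal ip_lt); rewrite /= (ltn_predK ji).
    have jip : (j <= ip)%N by rewrite -ltnS -Eip.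
    rewrite (prevf_succ f Eip).
    move/forallP/(_ i)/forallP/(_ j)/forallP/(_ j')/implyP: (h2 ip).
    rewrite /= Eip jj' jip !eqxx !Eent => /(_ isT) /andP[le1 le2].
    move/forallP/(_ i)/forallP/(_ j)/forallP/(_ j')/implyP: (h5 ip).
    rewrite /= Eip jj' jip !eqxx !Eent Edec /= => E5.
    move/forallP/(_ i)/forallP/(_ j)/implyP: (h6 ip).
    rewrite /= Eip jip !eqxx !Eent Edec /= => E6.
    apply/andP; split.
      move: E6 le1; rewrite leq_eqVlt; case: eqP => [-> /(_ isT) /eqP -> _ |_ _ /= lt1]; first by rewrite addn0.
      by case: (f i j).2; rewrite /= ?addn0 ?addn1 // ltnW.
    move: E5 le2; rewrite leq_eqVlt; case: (eqVneq (val (f i j').1) _) => [-> /(_ isT) /eqP -> _ |ne _ le2].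
      by rewrite addn1.
    by rewrite ltn_addr //; case/orP: le2 => // /eqP E; rewrite E eqxx in ne.
  apply/forallP=> j; rewrite (last_row il Eil).
  by move/forallP/(_ j)/implyP: (h4 il); rewrite Eent; apply; apply/eqP.
case/andP=> /forallP hc /forallP hb.
have step (i i' j j' : 'I_n) : i' = i.+1 :> nat -> j' = j.+1 :> nat -> (j <= i)%N ->
   ((f i' j).1 + dlo (f i' j).2 <= (f i j).1)%N /\ ((f i j).1 < (f i' j').1 + dup (f i' j').2)%N.
  move=> Ei Ej ji; have /andP[_ /forallP/(_ j)/forallP/(_ j')/implyP] := hc i'.
  by rewrite (prevf_succ f Ei) Ei Ej eqxx ltnS ji => /(_ isT) /andP.
apply/and5P; split; last (apply/andP; split).
- apply/forallP=> i; apply/forallP=> j; rewrite EA; have /andP[/forallP/(_ j) h _] := hc i.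
  exact: h.
- apply/forallP=> i; apply/forallP=> i'; apply/forallP=> j; apply/forallP=> j'.
  apply/implyP=> /and3P[/eqP Ei /eqP Ej ji]; rewrite !Eent.
  have [h1 h2] := step _ _ _ _ Ei Ej ji; apply/andP; split; first by apply: leq_trans h1; rewrite leq_addr.
  by move: h2; case: (f i' j').2; rewrite /= ?addn0 ?addn1 ?ltnS // => /ltnW.
- apply/forallP=> i; apply/forallP=> j; apply/forallP=> j'; apply/implyP=> /andP[/eqP Ej ji].
  rewrite !Eent; case: (eqVneq i.+1 n) => [Ein|nein].
    have hj := hb j; have hj' := hb j'; rewrite (last_row i Ein) in hj hj'.
    by rewrite (eqP hj) (eqP hj') Ej.
  have lt_i : (i.+1 < n)%N by rewrite ltn_neqAle nein ltn_ord.
  have lt_j : (j'.+1 < n)%N by apply: leq_ltn_trans lt_i; rewrite ltnS.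
  have [|_ h1] := step i (Ordinal lt_i) j j' erefl Ej; first by rewrite ltnW // -Ej.
  have [h2 _] := step i (Ordinal lt_i) j' (Ordinal lt_j) erefl erefl ji.
  by apply: leq_trans h1 _; apply: leq_trans h2; rewrite leq_add2l dup_dlo.
- apply/forallP=> i; apply/forallP=> j; apply/implyP=> /eqP Ein.
  by rewrite Eent -(last_row i Ein).
- apply/forallP=> i; apply/forallP=> i'; apply/forallP=> j; apply/forallP=> j'.
  apply/implyP=> /and4P[/eqP Ei /eqP Ej ji]; rewrite !Eent Edec => /eqP E.
  have [_] := step _ _ _ _ Ei Ej ji; rewrite -E -{1}[(f i' j').1 : nat]addn0 ltn_add2l lt0n.
  by move/dup1 => ->.
- apply/forallP=> i; apply/forallP=> i'; apply/forallP=> j.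
  apply/implyP=> /and3P[/eqP Ei ji]; rewrite !Eent Edec => /eqP E.
  have lt_j : (j.+1 < n)%N by apply: leq_ltn_trans (ltn_ord i'); rewrite Ei ltnS.
  have [h _] := step i i' j (Ordinal lt_j) Ei erefl ji; move: h.
  by rewrite -E -{2}[(f i' j).1 : nat]addn0 leq_add2l leqn0 => /eqP/dlo0 ->.
Qed.

Lemma dwtE y d : dwt u v w y d = (u * y) ^+ (d == DNE) * (v / y) ^+ (d == DNW) * w ^+ (d == DBoth).
Proof.
have E (a b : deco) : a <> b -> (a == b) = false by move/eqP/negbTE.
by case: d; rewrite eqxx 2?E // ?mul1r ?mulr1.
Qed.

Hypothesis X0 : forall i, X i != 0.

Lemma amt_weight_rows (f : {ffun 'I_n -> row}) :
  amt_weight u v w (fun i : 'I_n => X i) (amt_of_rows f) =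
  \prod_(i < n) arow_weight i (prevf t0 f i) (f i).
Proof.
set A := amt_of_rows f.
have EA i j : A (i, j) = f i j by rewrite ffunE.
have rowsumE (i : 'I_n) : rowsum A i = (\sum_(j : 'I_n | j <= i) (f i j).1)%N.
  rewrite /rowsum (eq_bigl (fun p : 'I_n * 'I_n => (p.1 == i) && (p.2 <= p.1)%N)) //.
  rewrite -(pair_big_dep (fun i' => i' == i) (fun i' j : 'I_n => (j <= i')%N) (fun i' j => ent A i' j)) /=.
  by rewrite big_pred1_eq; apply: eq_bigr => j _; rewrite /ent EA.
have prevsumE (i : 'I_n) : prevsum A i = (\sum_(j : 'I_n | j < i) (prevf t0 f i j).1)%N.
  case: i => [[|i] lti] /=; first by rewrite big_pred0.
  by rewrite (rowsumE (Ordinal (ltnW lti))) (insubT (fun i => i < n)%N (ltnW lti)).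
have cntE d (i : 'I_n) : cnt_row A d i = (\sum_(j : 'I_n | j <= i) ((f i j).2 == d))%N.
  rewrite /cnt_row -sum1_card big_mkcond [RHS]big_mkcond; apply: eq_bigr => j _.
  by rewrite inE /dec EA; case: (j <= i)%N => //=; case: eqP.
rewrite /amt_weight /cnt -!prodrXr -!big_split /=; apply: eq_bigr => i _.
rewrite /arow_weight big_split /= (eq_bigr _ (fun j _ => dwtE (X i) _)) !big_split /=.
rewrite !prodrXr -!cntE -rowsumE.
have -> : \prod_(j < n | (j < i)%N) X i ^- (prevf t0 f i j).1 = X i ^- prevsum A i.
  by rewrite prevsumE -exprVn -prodrXr; apply: eq_bigr => j _; rewrite exprVn.
rewrite /amt_xexp !(expfzDr, expfz_neq0) // -!exprnP -!invr_expz -!exprnP.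
rewrite !exprMn exprVn; move: (X i ^+ _) (X i ^+ cnt_row A DNE i) (X i ^- cnt_row A DNW i).
move: (u ^+ _) (v ^+ _) (w ^+ _) (X i ^- _) => a b c d e g h.
by ring.
Qed.

End AMTChain.

Definition vdm (F : comPzRingType) (X : nat -> F) (i : nat) : F :=
  \prod_(b < i) \prod_(a < b) (X b - X a).

Lemma vdmS (F : comPzRingType) (X : nat -> F) i :
  vdm X i.+1 = vdm X i * \prod_(a < i) (X i - X a).
Proof. by rewrite /vdm big_ord_recr. Qed.

Section AMTBethe.
Variables (F : fieldType) (u v w : F) (X : nat -> F) (n : nat).
Hypothesis X0 : forall i, X i != 0.
Local Notation entry := ('I_n.+1 * deco)%type.
Local Notation row := {ffun 'I_n -> entry}.
Local Notation e0 := ((ord0, DNW) : entry).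
Local Notation t0 := ([ffun=> e0] : row).

Definition atransfer (i : nat) (s t : row) : F := (acond i s t)%:R * arow_weight u v w X i s t.

Definition mkrow i (k : 'I_i -> 'I_n.+1) (d : 'I_i -> deco) : row :=
  padf e0 n [ffun b => (k b, d b)].

Lemma mkrow_lt i (k : 'I_i -> 'I_n.+1) (d : 'I_i -> deco) (j : 'I_n) (b : 'I_i) :
  j = b :> nat -> mkrow k d j = (k b, d b).
Proof. by move=> E; rewrite /mkrow (padf_lt _ _ E) ffunE. Qed.

Definition amt_gf i (k : {ffun 'I_i -> 'I_n.+1}) : F :=
  \sum_(d : {ffun 'I_i -> deco}) chainv t0 atransfer i (mkrow k d).

Lemma chainv_supp i (s : row) : ~~ [forall j : 'I_n, (i <= j)%N ==> (s j == e0)] ->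
  chainv t0 atransfer i s = 0.
Proof.
case: i => [|i] /=.
  move=> /forallPn [j] /= sj.
  by case: eqP => // Es; rewrite Es ffunE eqxx in sj.
move=> ns; apply: big1 => s' _; rewrite /atransfer /acond (negbTE ns) /=.
by rewrite mul0r mulr0.
Qed.

Lemma chainv_step i (k : {ffun 'I_i.+1 -> 'I_n.+1}) (d : {ffun 'I_i.+1 -> deco}) : (i < n)%N ->
  chainv t0 atransfer i.+1 (mkrow k d) =
  (\prod_b (dwt u v w (X i) (d b) * X i ^+ k b)) *
    \sum_(m : {ffun 'I_i -> 'I_n.+1} |
        [forall j : 'I_i, (k (lift ord_max j) + dlo (d (lift ord_max j)) <= m j
                           < k (lift ord0 j) + dup (d (lift ord0 j)))%N])
      (\prod_j X i ^- m j) * amt_gf m.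
Proof.
move=> lt_in /=.
rewrite (sum_padf (e0 := e0) (ltnW lt_in)) => [|s ns]; last by rewrite chainv_supp ?mul0r.
rewrite sum_ffun_pair big_distrr /= [RHS]big_mkcond /=; apply: eq_bigr => m _.
pose w_lt j : 'I_n := widen_ord lt_in j.
have Ek (b : 'I_i.+1) : mkrow k d (w_lt b) = (k b, d b) by apply: mkrow_lt.
have Em (d' : 'I_i -> deco) (j : 'I_i) : mkrow m d' (w_lt (lift ord_max j)) = (m j, d' j).
  by apply: mkrow_lt; rewrite /= /bump leqNgt ltn_ord.
have condE (d' : {ffun 'I_i -> deco}) : acond i (mkrow m d') (mkrow k d) =
   [forall j : 'I_i, (k (lift ord_max j) + dlo (d (lift ord_max j)) <= m j
                           < k (lift ord0 j) + dup (d (lift ord0 j)))%N].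
  rewrite /acond [X in X && _](_ : _ = true) /=; last first.
    by apply/forallP=> j; apply/implyP=> ij; rewrite /mkrow padf_ge.
  apply/forallP/forallP => H j.
    move/forallP/(_ (w_lt (lift ord0 j)))/implyP: (H (w_lt (lift ord_max j))).
    rewrite !Ek Em /=; apply.
    by rewrite /bump [(i <= j)%N]leqNgt ltn_ord /= add0n ltn_ord andbT.
  apply/forallP=> j'; apply/implyP=> /andP[/eqP jj' ji].
  have Ej : j = w_lt (lift ord_max (Ordinal ji)).
    by apply: val_inj; rewrite /= /bump leqNgt ji.
  have Ej' : j' = w_lt (lift ord0 (Ordinal ji)) by apply: val_inj; rewrite /= jj'.
  by rewrite Ej Ej' Em !Ek; apply: (H (Ordinal ji)).
have weightE (d' : {ffun 'I_i -> deco}) : arow_weight u v w X i (mkrow m d') (mkrow k d) =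
   (\prod_b (dwt u v w (X i) (d b) * X i ^+ k b)) * \prod_j X i ^- m j.
  rewrite /arow_weight; congr (_ * _).
    rewrite (eq_bigl (fun j : 'I_n => j < i.+1)%N) // (big_ord_narrow lt_in) /=; apply: eq_bigr => b _.
    by rewrite (_ : widen_ord _ b = w_lt b) ?Ek //; apply: val_inj.
  rewrite (big_ord_narrow (ltnW lt_in)) /=; apply: eq_bigr => j _.
  rewrite (_ : widen_ord _ j = w_lt (lift ord_max j)) ?Em //; apply: val_inj.
  by rewrite /= /bump leqNgt ltn_ord.
under eq_bigr => d' _ do rewrite -/(mkrow m d') /atransfer condE weightE.
rewrite -big_distrl /= -/(amt_gf m); case: ifP => _; last by rewrite mul0r mulr0.
by rewrite mul1r; ring.
Qed.

(** Row i brings the new Vandermonde factors X_i - X_a, exactly those that [bethe_step] consumes.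
    That step needs a strictly increasing row, a property which the row above inherits. *)
Lemma amt_gf_bethe i (k : {ffun 'I_i -> 'I_n.+1}) : (i <= n)%N ->
  (forall b b' : 'I_i, b' = b.+1 :> nat -> (k b < k b')%N) ->
  vdm X i * amt_gf k =
  (\prod_(a < i) (X a)^-1) * bethe u v w (fun a : 'I_i => X a) (fun b => k b).
Proof.
elim: i k => [|i IH] k le_in k_mono.
  rewrite /vdm !big_ord0 !mul1r /amt_gf /bethe.
  rewrite (big_pred1 [ffun=> DNW]) => [|d]; last by apply/esym/eqP/ffunP; case.
  rewrite (big_pred1 1%g) => [|s]; last by apply/esym/eqP/permP; case.
  rewrite odd_perm1 expr0 mul1r /scat_prod !big_ord0 mulr1 /=.
  rewrite (_ : _ == _) //; apply/eqP/ffunP=> j.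
  by rewrite /mkrow padf_ge // ffunE.
pose kn j : nat := if insub j is Some b then k b else 0.
have knE (b : 'I_i.+1) : kn b = k b by rewrite /kn (valK b).
have kn_lt j : (j < i)%N -> (kn j < kn j.+1 < n.+1)%N.
  move=> ji; rewrite /kn (insubT (fun j => j < i.+1)%N (leqW ji)) (insubT (fun j => j < i.+1)%N (ji : (j.+1 < i.+1)%N)) /=.
  by rewrite ltn_ord andbT k_mono.
have := bethe_step u v w (fun a : 'I_i => X a) (X0 i) kn_lt.
rewrite vdmS big_ord_recr /=.
have -> : bethe u v w (extend (fun a : 'I_i => X a) (X i)) (fun b : 'I_i.+1 => kn b)
   = bethe u v w (fun a : 'I_i.+1 => X a) (fun b => k b).
  apply: eq_bigr => s _; congr (_ * (_ * _)).
    have E a : extend (fun a : 'I_i => X a) (X i) a = X a.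
      by rewrite /extend; case: unliftP => [j ->|->] //=; rewrite /bump leqNgt ltn_ord.
    by apply: eq_bigr => a _; apply: eq_bigr => b _; rewrite /= !E.
  apply: eq_bigr => a _; rewrite knE; congr (_ ^+ _).
  by rewrite /extend; case: unliftP => [j ->|->] //=; rewrite /bump leqNgt ltn_ord.
move=> step; rewrite -[RHS]mulrA -step {step} mulrAC mulrC [RHS]mulrCA; congr (_ * _).
rewrite {1}/amt_gf !big_distrr; apply: eq_bigr => d _.
rewrite chainv_step //= mulrCA [RHS]mulrCA; congr (_ * _).
  by apply: eq_bigr => b _; rewrite knE.
rewrite !big_distrr /=; apply: eq_big => [m|m /forallP cm].
  apply: eq_forallb => j.
  by rewrite -!knE (_ : kn (lift ord_max j) = kn j) // lift_max.
rewrite mulrCA [RHS]mulrCA; congr (_ * _); apply: IH => [|b b' bb']; first exact: ltnW.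
have /andP[_ h1] := cm b; have /andP[h2 _] := cm b'.
apply: (leq_trans h1); apply: leq_trans h2.
have -> : lift ord0 b = lift ord_max b'.
  by apply: val_inj; rewrite /= /bump [(i <= b')%N]leqNgt ltn_ord bb'.
by rewrite leq_add2l dup_dlo.
Qed.

Lemma amt_sum_gf : (0 < n)%N ->
  \sum_(A : amt n | is_amt A) amt_weight u v w (fun i : 'I_n => X i) A =
  amt_gf [ffun b : 'I_n => inord b.+1].
Proof.
move=> n0; rewrite big_mkcond sum_ffun_curry /=.
pose bottom (t : row) := [forall j : 'I_n, (t j).1 == j.+1 :> nat].
transitivity (\sum_(f : {ffun 'I_n -> row})
   (\prod_(i < n) atransfer i (prevf t0 f i) (f i)) * (bottom (prevf t0 f n))%:R).
  apply: eq_bigr => f _; rewrite -/(amt_of_rows f) is_amt_rows // amt_weight_rows //.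
  rewrite /atransfer [X in _ = X * _]big_split /=.
  case: (boolP [forall i : 'I_n, acond i (prevf t0 f i) (f i)]) => [/forallP h|/forallPn[i /negbTE ni]] /=.
    rewrite -/(bottom _) [X in _ = X * _ * _]big1 ?mul1r => [|i _]; last by rewrite h.
    by case: ifP; rewrite ?mulr1 ?mulr0.
  by rewrite (bigD1 i) //= ni !mul0r.
rewrite (chain_sum t0 atransfer n (fun t => (bottom t)%:R)) sum_ffun_pair (bigD1 [ffun b : 'I_n => inord b.+1]) //= [X in _ + X]big1 ?addr0.
  apply: eq_bigr => d _; rewrite (_ : bottom _ = true) ?mulr1.
    congr (chainv _ _ _ _); apply/ffunP=> j.
    by rewrite (@mkrow_lt _ _ _ j j) // !ffunE.
  by apply/forallP=> j; rewrite !ffunE /= inordK // ltnS ltn_ord.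
move=> m nm; apply: big1 => d _; rewrite (_ : bottom _ = false) ?mulr0 //.
apply: contraNF nm => /forallP bm; apply/eqP/ffunP=> j; apply: val_inj.
by move/eqP: (bm j); rewrite !ffunE /= inordK // ltnS.
Qed.

End AMTBethe.

(** * Branching of the bialternants *)

(** Here the bottom row (1, ..., n) matters. The variable in position i (counted from 0) has
    exponent n - i from the scattering factors, i + 1 from the bottom row and - 1 from the
    prefactor. The total n does not depend on i, so the monomial leaves the antisymmetrizer. *)
Lemma amt_det (F : fieldType) (u v w : F) (X : nat -> F) n : (0 < n)%N ->
  (forall i, X i != 0) ->
  vdm X n * \sum_(A : amt n | is_amt A) amt_weight u v w (fun i : 'I_n => X i) A =
  (\prod_(i < n) X i ^+ n) *
    \det (powdiff_mx (fun i : 'I_n => u * X i) (fun i : 'I_n => - w - v / X i)).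
Proof.
move=> n0 X0; rewrite amt_sum_gf // amt_gf_bethe // => [|b b' bb']; last first.
  by rewrite !ffunE !inordK ?ltnS ?ltn_ord // bb'.
rewrite -asym_det /bethe !big_distrr /=; apply: eq_bigr => s _.
rewrite mulrCA [RHS]mulrCA; congr (_ * _).
have scatE (a b : 'I_n) : scat u v w (X a) (X b) = X a * (u * X b - (- w - v / X a)).
  by rewrite /scat; field; apply: X0.
have -> : scat_prod u v w ((fun a : 'I_n => X a) \o s) =
   (\prod_(i < n) X (s i) ^+ (n - i)) *
   \prod_(i < n) \prod_(j < n | (i <= j)%N) (u * X (s j) - (- w - v / X (s i))).
  rewrite -big_split; apply: eq_bigr => i _ /=.
  rewrite (eq_bigr _ (fun j _ => scatE _ _)) big_split /=; congr (_ * _).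
  by rewrite -(big_geq_mkord _ _ predT (fun=> X (s i))) prodr_const_nat.
rewrite mulrAC mulrA; congr (_ * _).
rewrite [\prod_(a < n) (X a)^-1](reindex_inj (@perm_inj _ s)).
rewrite [RHS](reindex_inj (@perm_inj _ s)) -!big_split /=; apply: eq_bigr => i _.
rewrite ffunE inordK ?ltnS ?ltn_ord // -exprD.
by rewrite addnS subnK ?exprS ?mulKf // ltnW.
Qed.

(** Subtracting from each row the next one, by the unitriangular [U], clears the last column except
    for its bottom 1. *)
Lemma det_row_diff (F : comUnitRingType) r (A : 'M[F]_r.+1) : (forall j, A j ord_max = 1) ->
  \det A = \det (\matrix_(j < r, i < r)
     (A (lift ord_max j) (lift ord_max i) - A (lift ord0 j) (lift ord_max i))).
Proof.
move=> A1.
pose U : 'M[F]_r.+1 := \matrix_(j, k) ((j == k)%:R - (k == j.+1 :> nat)%:R).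
have detU : \det U = 1.
  rewrite -det_tr det_trig; last first.
    apply/is_trig_mxP => i j ij; rewrite !mxE -val_eqE /= gtn_eqF // [_ == _](_ : _ = false) ?subrr //.
    by apply/negbTE/eqP => E; move: ij; rewrite E; lia.
  by apply: big1 => i _; rewrite !mxE eqxx ltn_eqF ?subr0.
have UA j i : (U *m A) j i = A j i - (if unlift ord_max j is Some j' then A (lift ord0 j') i else 0).
  rewrite mxE; under eq_bigr => k _ do rewrite mxE mulrBl.
  rewrite sumrB; congr (_ - _).
    by rewrite (bigD1 j) //= eqxx mul1r big1 ?addr0 // => k; rewrite eq_sym => /negbTE ->; rewrite mul0r.
  case: unliftP => [j' ->|->].
    rewrite lift_max (bigD1 (lift ord0 j')) // lift0 eqxx mul1r big1 /= ?addr0 // => k.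
    by rewrite -val_eqE [val (lift _ _)]lift0 => /negbTE ->; rewrite mul0r.
  by apply: big1 => k _; rewrite ltn_eqF ?mul0r.
rewrite -[LHS]mul1r -detU -det_mulmx (expand_det_col _ ord_max) (bigD1 ord_max) //=.
rewrite big1 ?addr0 => [|j jm].
  rewrite UA unlift_none subr0 A1 mul1r /cofactor addnn -signr_odd odd_double mul1r.
  by congr (\det _); apply/matrixP=> j i; rewrite [LHS]mxE [LHS]mxE UA liftK mxE.
rewrite UA; case: unliftP jm => [j' _ _|->]; last by rewrite eqxx.
by rewrite !A1 subrr mul0r.
Qed.

Lemma det_sum_rows (F : comNzRingType) r (J : finType) (Q : 'I_r -> pred J)
    (c : 'I_r -> J -> F) (H : 'I_r -> J -> 'I_r -> F) :
  \det (\matrix_(j, i) \sum_(l | Q j l) c j l * H j l i) =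
  \sum_(f : {ffun 'I_r -> J} | [forall j, Q j (f j)])
     (\prod_j c j (f j)) * \det (\matrix_(j, i) H j (f j) i).
Proof.
transitivity (\sum_(s : 'S_r) \sum_(f : {ffun 'I_r -> J} | [forall j, Q j (f j)])
   (-1) ^+ s * \prod_j (c j (f j) * H j (f j) (s j))).
  apply: eq_bigr => s _; rewrite -big_distrr /=; congr (_ * _).
  rewrite (sum_ffun_forall Q (fun j l => c j l * H j l (s j))).
  by apply: eq_bigr => j _; rewrite mxE.
rewrite exchange_big /=; apply: eq_bigr => f _; rewrite big_distrr /=.
apply: eq_bigr => s _; rewrite big_split /= mulrCA; congr (_ * (_ * _)).
by apply: eq_bigr => j _; rewrite mxE.
Qed.

Section Branching.
Variables (F : fieldType) (u v w : F).

(* Single-variable factor of the bialternant of a shape: a row of length [l] and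
   index [j] among [N] rows has exponent [e = l + (N.-1 - j)], and crosses the
   diagonal iff [N <= e]. *)
Definition phi (N e : nat) (x : F) : F :=
  if (e < N)%N then v * x ^+ e * (v + w * x) ^+ (N.-1 - e) else u ^+ (e - N) * x ^+ e.

(** The coefficient forced by [phi_telescope]: what remains of a difference of normalized row
    factors after removing x - y and the factor [phi] for one row fewer. *)
Definition kap (r e : nat) (y : F) : F :=
  if (e < r)%N then y ^- e.+1 * (v + w * y) ^- (r - e) else u ^- (e - r) * y ^- e.+1.

Definition phi_mx r (l : 'I_r -> nat) (x : 'I_r -> F) : 'M[F]_r :=
  \matrix_(j, i) phi r (l j + (r.-1 - j)) (x i).

Hypotheses (u0 : u != 0) (v0 : v != 0).

Lemma phi_neq0 N e y : y != 0 -> v + w * y != 0 -> phi N e y != 0.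
Proof. by move=> y0 q0; rewrite /phi; case: ifP => _; rewrite !mulf_neq0 ?expf_neq0. Qed.

(** Before the diagonal this is x (v + w y) - y (v + w x) = v (x - y), which accounts for the
    isolated v in [phi]; beyond it, only powers of x and y change. *)
Lemma phi_telescope r e x y : y != 0 -> v + w * y != 0 ->
  phi r.+1 e.+1 x / phi r.+1 e.+1 y - phi r.+1 e x / phi r.+1 e y
  = (x - y) * (kap r e y * phi r e x).
Proof.
move=> y0 q0; rewrite /phi /kap ltnS.
case: (ltnP e r) => er.
  rewrite (leqW er) /=.
  have [d ->] : exists d, r = (e + d).+1 by exists (r - e.+1)%N; rewrite -addSn subnKC.
  have -> : ((e + d).+1 - e.+1 = d)%N by lia.
  have -> : ((e + d).+1 - e = d.+1)%N by lia.
  have -> : (e + d - e = d)%N by lia.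
  rewrite !exprS; have := expf_neq0 e y0; have := expf_neq0 d q0.
  move: (y ^+ e) ((v + w * y) ^+ d) (x ^+ e) ((v + w * x) ^+ d) => a b c f b0 a0.
  by field; rewrite v0 y0 q0 a0 b0.
have [d ->] : exists d, e = (r + d)%N by exists (e - r)%N; rewrite subnKC.
have -> : (r + d - r = d)%N by lia.
have -> : ((r + d).+1 - r.+1 = d)%N by lia.
have Y := expf_neq0 (r + d) y0; have U := expf_neq0 d u0.
(* The crossing case e = r: only e + 1 has reached the diagonal, and the factor v cancels within the
   other ratio. *)
case: ltnP => [lt_d|].
  have -> : d = 0%N by lia.
  have Y' := expf_neq0 r y0.
  rewrite !addn0 /= subnn !expr0 !exprS; move: (y ^+ r) (x ^+ r) Y' => a c a0.
  by field; rewrite a0 y0 oner_neq0 v0.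
move=> le_d; rewrite !exprS.
have U' := expf_neq0 (r + d - r.+1) u0.
move: (y ^+ (r + d)) (x ^+ (r + d)) (u ^+ d) (u ^+ (r + d - r.+1)) Y U U' => a c b f a0 b0 f0.
by field; rewrite y0 a0 b0 f0.
Qed.

(** Analogue of the branching rule of Schur functions. Dividing each row by its value at y makes the
    column of y constant; differences of consecutive rows then telescope into sums over the
    interlacing parts, and multilinearity pulls these sums out. *)
Lemma phi_branching r M (l : nat -> nat) (x : 'I_r -> F) (y : F) :
  y != 0 -> v + w * y != 0 -> (forall j, (j < r)%N -> (l j.+1 <= l j < M)%N) ->
  \det (phi_mx (fun j : 'I_r.+1 => l j) (extend x y)) =
  (\prod_(j < r.+1) phi r.+1 (l j + (r - j)) y) * (\prod_i (x i - y)) *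
  \sum_(m : {ffun 'I_r -> 'I_M} | [forall j : 'I_r, (l j.+1 <= m j <= l j)%N])
     (\prod_(j < r) kap r (m j + (r.-1 - j)) y) * \det (phi_mx (fun j => m j) x).
Proof.
move=> y0 q0 lM.
pose c (j : 'I_r.+1) := phi r.+1 (l j + (r - j)) y.
pose A : 'M[F]_r.+1 := \matrix_(j, i) (phi r.+1 (l j + (r - j)) (extend x y i) / c j).
have c0 j : c j != 0 by apply: phi_neq0.
have -> : phi_mx (fun j : 'I_r.+1 => l j) (extend x y) = diag_mx (\row_j c j) *m A.
  apply/matrixP=> j i; rewrite mul_diag_mx !mxE /=.
  by rewrite mulrCA divff ?mulr1.
rewrite det_mulmx det_diag -mulrA; congr (_ * _); first by apply: eq_bigr => j _; rewrite mxE.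
rewrite det_row_diff => [|j]; last by rewrite mxE /extend unlift_none -/(c j) divff.
have -> : \prod_i (x i - y) = \det (diag_mx (\row_i (x i - y))).
  by rewrite det_diag; apply: eq_bigr => i _; rewrite mxE.
rewrite -(det_sum_rows (fun (j : 'I_r) (m : 'I_M) => (l j.+1 <= m <= l j)%N)
   (fun (j : 'I_r) (m : 'I_M) => kap r (m + (r.-1 - j)) y)
   (fun (j : 'I_r) (m : 'I_M) i => phi r (m + (r.-1 - j)) (x i))).
rewrite mulrC -det_mulmx; congr (\det _); apply/matrixP=> j i.
rewrite mul_mx_diag !mxE /extend liftK /c lift_max lift0 big_distrl /=.
have /andP[ll lt_M] := lM j (ltn_ord j).
(* Among r + 1 rows the offset of row j is one larger than among r rows; so the telescoping ends at
   [(l j).+1] and the value m = [l j] is included. *)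
pose G m := phi r.+1 (m + (r.-1 - j)) (x i) / phi r.+1 (m + (r.-1 - j)) y.
transitivity (G (l j).+1 - G (l j.+1)).
  rewrite /G; have jr := ltn_ord j.
  have -> : (r - j = (r.-1 - j).+1)%N by lia.
  have -> : (r - j.+1 = r.-1 - j)%N by lia.
  by rewrite addSnnS.
rewrite -(telescope_sumr G (leqW ll)) (big_nat_widen _ _ M) //= big_geq_mkord /=.
apply: eq_big => [m|m _]; first by rewrite ltnS andbC.
by rewrite /G addSn phi_telescope // mulrC.
Qed.

End Branching.

(** * Determinant sum over near-balanced shapes *)

(* The near-balanced shapes with at most [m] rows, each with its exponent of [w].
   Either the last row is empty, or the first column has length [m], the first row
   has length [m.+1] or [m.+2], and the outer hook can be peeled off. *)
Fixpoint nbl m : seq (nat * seq nat) :=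
  if m is m'.+1 then
    [seq (p.1, rcons p.2 0%N) | p <- nbl m'] ++
    ([seq (p.1.+1, m'.+1 :: map S p.2) | p <- nbl m' & (head 0%N p.2 <= m')%N] ++
     [seq (p.1, m'.+2 :: map S p.2) | p <- nbl m'])
  else [:: (0%N, [::])].

Lemma nbl_size_head m p : p \in nbl m -> size p.2 = m /\ (head 0%N p.2 <= m.+1)%N.
Proof.
elim: m p => [|m IH] p /=; first by rewrite inE => /eqP ->.
rewrite !mem_cat => /or3P[] /mapP[q].
- move=> /IH [sq hq] -> /=; rewrite size_rcons sq; split=> //.
  by case: q.2 hq => //= a l /leqW.
- by rewrite mem_filter => /andP[_ /IH [sq hq]] -> /=; rewrite size_map sq.
by move=> /IH [sq hq] -> /=; rewrite size_map sq.
Qed.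

Definition repl_row (F : comPzRingType) n (R : 'I_n -> 'rV[F]_n) (i0 : 'I_n) (x : 'rV[F]_n) : 'M_n :=
  \matrix_(j < n) (if j == i0 then x else R j).

Lemma det_repl_row (F : comPzRingType) n (R : 'I_n -> 'rV[F]_n) (i0 : 'I_n) (x : 'rV[F]_n) :
  \det (repl_row R i0 x) = \sum_k x 0 k * cofactor (repl_row R i0 0) i0 k.
Proof.
rewrite (expand_det_row _ i0); apply: eq_bigr => k _; rewrite mxE eqxx; congr (_ * _).
rewrite /cofactor; congr (_ * \det _); apply/matrixP=> i j; rewrite !mxE.
by rewrite eq_sym (negbTE (neq_lift _ _)).
Qed.

Lemma det_repl_rowD (F : comPzRingType) n (R : 'I_n -> 'rV[F]_n) i0 x y :
  \det (repl_row R i0 (x + y)) = \det (repl_row R i0 x) + \det (repl_row R i0 y).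
Proof.
rewrite !(det_repl_row _ _ (_ + _)) (det_repl_row _ _ x) (det_repl_row _ _ y) -big_split /=.
by apply: eq_bigr => k _; rewrite mxE mulrDl.
Qed.

Lemma det_repl_rowZ (F : comPzRingType) n (R : 'I_n -> 'rV[F]_n) i0 a x :
  \det (repl_row R i0 (a *: x)) = a * \det (repl_row R i0 x).
Proof.
rewrite (det_repl_row _ _ (_ *: _)) (det_repl_row _ _ x) big_distrr /=.
by apply: eq_bigr => k _; rewrite mxE mulrA.
Qed.

Section Hooks.
Variables (F : comNzRingType) (w : F) (n : nat) (psi : nat -> 'rV[F]_n).

(* The three options of [nbl] only touch the last row or, after a cyclic shift of
   sign [(-1) ^+ c], the first row; in the determinant they merge into one row. *)
Definition hookrow c : 'rV[F]_n :=
  psi (n.-1 - c)%N + (-1) ^+ c *: (w *: psi (n + c)%N + psi (n + c).+1).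

(** Interpolates between the matrix of a shape (m = n) and the merged matrix (m = 0). *)
Definition mixrow m (l : seq nat) (j : 'I_n) : 'rV[F]_n :=
  if (j < m)%N then psi (nth 0%N l j + (n.-1 - j))%N else hookrow j.

End Hooks.

(** Raising a part by one while moving it one row down keeps its exponent. Adding a hook thus only
    moves rows 0, ..., m - 1 down and places the row of a on top; the cycle that brings it to
    position m has sign (-1)^m. *)
Lemma det_mix_cons (F : comNzRingType) (w : F) n (psi : nat -> 'rV[F]_n) m (l : seq nat) a
    (mn : (m < n)%N) : size l = m ->
  \det (\matrix_(j < n) mixrow w psi m.+1 (a :: map S l) j) =
  (-1) ^+ m * \det (repl_row (mixrow w psi m l) (Ordinal mn) (psi (a + n.-1)%N)).
Proof.
case: n psi mn => [//|n] psi mn sl; set R := repl_row _ _ _.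
have -> : \matrix_(j < n.+1) mixrow w psi m.+1 (a :: map S l) j =
   row_perm (lift_perm ord0 (Ordinal mn) 1%g) R.
  apply/row_matrixP=> j; rewrite rowK.
  have -> : row j (row_perm (lift_perm ord0 (Ordinal mn) 1%g) R)
    = row (lift_perm ord0 (Ordinal mn) 1%g j) R.
    by apply/rowP=> i; rewrite !mxE.
  rewrite rowK; case: (unliftP ord0 j) => [j' ->|->].
    rewrite lift_perm_lift perm1 eq_sym (negbTE (neq_lift _ _)) /mixrow lift0 /= ltnS.
    case: (ltnP j' m) => jm.
      rewrite /bump [(m <= j')%N]leqNgt jm /= add0n jm (nth_map 0%N) ?sl //; congr psi.
      have jn : (j' < n)%N := ltn_ord j'; move: (nat_of_ord j') jn => i jn; lia.
    by rewrite /bump jm /= add1n ltnNge leqW.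
  by rewrite lift_perm_id eqxx /mixrow /= subn0.
rewrite row_permE det_mulmx det_perm odd_lift_perm /= odd_perm1 addbF signr_odd.
by [].
Qed.

(** Row m is the only one in which the three families of [nbl m.+1] over a given element of [nbl m]
    differ, once hooks are moved by [det_mix_cons]; their sum is [hookrow] at m, by linearity in
    that row. *)
Lemma sum_nbl_det (F : comNzRingType) (w : F) n (psi : nat -> 'rV[F]_n) m : (m <= n)%N ->
  \sum_(p <- nbl m) w ^+ p.1 * \det (\matrix_(j < n) mixrow w psi m p.2 j) =
  \det (\matrix_(j < n) hookrow w psi j).
Proof.
elim: m => [|m IH] mn.
  by rewrite big_seq1 mul1r; congr (\det _); apply/matrixP=> i j; rewrite !mxE.
rewrite -(IH (ltnW mn)) /= !big_cat !big_map big_filter /=.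
have -> : \sum_(p <- nbl m | (head 0%N p.2 <= m)%N)
     w ^+ p.1.+1 * \det (\matrix_(j < n) mixrow w psi m.+1 (m.+1 :: map S p.2) j) =
   \sum_(p <- nbl m) w ^+ p.1.+1 * \det (\matrix_(j < n) mixrow w psi m.+1 (m.+1 :: map S p.2) j).
  rewrite big_mkcond big_seq [RHS]big_seq; apply: eq_bigr => p /nbl_size_head [sp hp].
  case: leqP => // hm; have {hp hm} hp : head 0%N p.2 = m.+1 by apply/anti_leq; rewrite hp hm.
  case: p sp hp => a [|b l] //= sl bm; rewrite bm.
  have n2 : (1 < n)%N by apply: leq_ltn_trans mn; rewrite -sl.
  have n1 := ltnW n2.
  rewrite (determinant_alternate (i1 := Ordinal n1) (i2 := Ordinal n2)) ?mulr0 //.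
  move=> i; rewrite !mxE /mixrow /= ltnS -sl /=; congr (psi _ _ _); lia.
rewrite -!big_split /= big_seq [RHS]big_seq; apply: eq_bigr => p /nbl_size_head [sp _].
rewrite !det_mix_cons //.
have rowE (l : seq nat) : \matrix_(j < n) mixrow w psi m l j = repl_row (mixrow w psi m l) (Ordinal mn) (hookrow w psi m).
  apply/row_matrixP=> j; rewrite !rowK; case: eqP => [->|//].
  by rewrite /mixrow /= ltnn.
have -> : \matrix_(j < n) mixrow w psi m.+1 (rcons p.2 0%N) j =
   repl_row (mixrow w psi m p.2) (Ordinal mn) (psi (n.-1 - m)%N).
  apply/row_matrixP=> j; rewrite !rowK; case: eqP => [->|ne].
    by rewrite /mixrow /= ltnSn nth_rcons sp ltnn eqxx.
  have nem : j != m :> nat by apply/eqP => E; apply: ne; apply: val_inj.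
  by rewrite /mixrow ltnS leq_eqVlt (negbTE nem) nth_rcons sp /=; case: ltnP.
rewrite rowE det_repl_rowD !(det_repl_rowZ, det_repl_rowD).
have -> : (m.+1 + n.-1 = n + m)%N by lia.
have -> : (m.+2 + n.-1 = (n + m).+1)%N by lia.
by rewrite exprS; ring.
Qed.


Lemma nbl_phi_det (F : fieldType) (u v w : F) n (x : 'I_n -> F) : (forall i, x i != 0) ->
  \sum_(p <- nbl n) w ^+ p.1 * \det (phi_mx u v w (fun j : 'I_n => nth 0%N p.2 j) x) =
  (\prod_(i < n) (-1) ^+ i) * (\prod_(i < n) x i ^+ n) *
   \det (powdiff_mx (fun i => u * x i) (fun i => - w - v / x i)).
Proof.
move=> x0; pose psi e : 'rV[F]_n := \row_i phi u v w n e (x i).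
transitivity (\sum_(p <- nbl n) w ^+ p.1 * \det (\matrix_(j < n) mixrow w psi n p.2 j)).
  apply: eq_bigr => p _; congr (_ * \det _); apply/matrixP=> j i.
  by rewrite !mxE /mixrow ltn_ord mxE.
rewrite sum_nbl_det //; pose f i := u * x i; pose g i := - w - v / x i.
(* [L] forms the combinations (-1)^c (T_(c+1) + w T_c). It is triangular, so only the signs on its
   diagonal survive in the determinant. *)
pose L : 'M[F]_n := \matrix_(c, j) ((-1) ^+ c * ((j == c)%:R + w * (c == j.+1 :> nat)%:R)).
have -> : \matrix_(j < n) hookrow w psi j = L *m (powdiff_mx f g)^T *m diag_mx (\row_i x i ^+ n).
  apply/matrixP=> c i; rewrite mul_mx_diag !mxE /=.
  have -> : \sum_j L c j * (powdiff_mx f g)^T j i =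
     (-1) ^+ c * (f i ^+ c.+1 - g i ^+ c.+1 + w * (f i ^+ c - g i ^+ c)).
    under eq_bigr => j _ do rewrite !mxE -mulrA mulrDl.
    rewrite -big_distrr big_split /=; congr (_ * (_ + _)).
      by rewrite (bigD1 c) //= eqxx mul1r big1 ?addr0 // => j /negbTE ->; rewrite mul0r.
    case: c => [[|c] ltc] /=.
      by rewrite subrr mulr0 big1 // => j _; rewrite mul0r.
    rewrite (bigD1 (Ordinal (ltnW ltc))) //= eqxx mulr1 big1 ?addr0 // => j.
    by rewrite -val_eqE /= eqSS eq_sym => /negbTE ->; rewrite mulr0 mul0r.
  have cn := ltn_ord c.
  have E1 : (n.-1 - c < n)%N by lia.
  have E2 : (n + c < n)%N = false by lia.
  have E3 : ((n + c).+1 < n)%N = false by lia.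
  rewrite /phi E1 E2 E3.
  have -> : (n.-1 - (n.-1 - c) = c)%N by lia.
  have -> : (n + c - n = c)%N by lia.
  have -> : ((n + c).+1 - n = c.+1)%N by lia.
  have -> : x i ^+ (n + c).+1 = x i ^+ n * x i ^+ c * x i by rewrite exprSr exprD.
  have En : x i ^+ n = x i * x i ^+ c * x i ^+ (n.-1 - c).
    by rewrite -exprS -exprD; congr (_ ^+ _); lia.
  (* This turns - g^(c+1) - w g^c into (v / x) g^c, which up to (-1)^c x^n is the term v x^(n-1-c)
     (v + w x)^c of an empty last row. *)
  have -> : g i ^+ c.+1 = - (w + v / x i) * g i ^+ c by rewrite exprS /g opprD.
  have -> : g i ^+ c = (-1) ^+ c * (w + v / x i) ^+ c.
    by rewrite -exprMn mulN1r opprD.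
  have -> : (v + w * x i) ^+ c = x i ^+ c * (w + v / x i) ^+ c.
    by rewrite -exprMn; congr (_ ^+ _); field.
  rewrite exprD En /f !exprMn !exprS.
  have S : (-1) ^+ c * (-1) ^+ c = 1 :> F by rewrite -expr2 sqrr_sign.
  move: ((-1) ^+ c) S (x i ^+ c) (x i ^+ (n.-1 - c)) (u ^+ c) ((w + v / x i) ^+ c) => s S a b d e.
  have -> : v * b * (a * e) = (s * s) * (v * b * (a * e)) by rewrite S mul1r.
  by field.
rewrite !det_mulmx det_tr det_diag.
have -> : \det L = \prod_(i < n) (-1) ^+ i.
  rewrite det_trig; last first.
    apply/is_trig_mxP => c j cj; rewrite mxE -val_eqE /= gtn_eqF //.
    by rewrite [_ == _]ltn_eqF ?leqW // mulr0 addr0 mulr0.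
  by apply: eq_bigr => c _; rewrite mxE eqxx ltn_eqF // mulr0 addr0 mulr1.
rewrite mulrAC; congr (_ * _ * _).
by apply: eq_bigr => i _; rewrite mxE.
Qed.

(** * Adding a layer to a set-valued filling *)

Lemma prod_telescope (F : fieldType) (a b : nat) (G : nat -> F) :
  (forall k, G k != 0) -> (a <= b)%N ->
  \prod_(a <= k < b) (G k.+1 / G k) = G b / G a.
Proof.
move=> G0; rewrite leq_eqVlt => /orP[/eqP->|ab]; first by rewrite big_geq // divff.
by rewrite telescope_prodf.
Qed.

Section Layers.
Variables (F : fieldType) (u v w : F) (Y : nat -> F) (n : nat).
Local Notation shape := {ffun 'I_n -> 'I_n.+2}.
Local Notation cell := ('I_n * 'I_n.+1)%type.
Local Notation layer := (shape * {set cell})%type.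
Local Notation empty := ([ffun=> ord0] : shape).

Definition part (l : shape) (j : nat) : nat := if insub j is Some b then l b else 0.

Definition in_shape (l : shape) (p : cell) : bool := (p.2 < l p.1)%N.

(** The difference of the two shapes is a horizontal strip, that is, it has at most one cell in each
    column. *)
Definition interlace (m l : shape) : bool :=
  [forall r : 'I_n, (part l r.+1 <= m r <= l r)%N].

(* The layer [S] is the set of cells containing a given value and [m], [l] are the
   shapes of the cells whose maximum exceeds, resp. is at least, that value. *)
Definition layer_cell (m l : shape) (p : cell) (b : bool) : bool :=
  if b then in_shape l p && (in_shape m p ==> (p.2 <= p.1)%N && (part l p.1.+1 <= p.2)%N)
  else in_shape l p ==> in_shape m p.

Definition cell_coef (p : cell) : F := (if (p.2 <= p.1)%N then 1 else u) / w.

(* Since the shapes [m] increase from empty to the full shape, the last factor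
   telescopes and charges each cell once for [u] and [w^-1]. *)
Definition layer_cell_weight (y : F) (m l : shape) (p : cell) (b : bool) : F :=
  (if b then y * w * (if (p.2 <= p.1)%N then v^-1 else 1) else 1) *
  (cell_coef p ^+ in_shape l p / cell_coef p ^+ in_shape m p).

(** Over n steps the powers [v ^+ i.+1] accumulate to the exponent binom(n+1, 2), from which the
    factors [v^-1] of the cells subtract one per entry on or below the diagonal. *)
Definition layer_transfer (i : nat) (s t : layer) : F :=
  (interlace s.1 t.1)%:R * (v ^+ i.+1 *
  \prod_p ((layer_cell s.1 t.1 p (p \in t.2))%:R *
           layer_cell_weight (Y i) s.1 t.1 p (p \in t.2))).

Definition shape_transfer (i : nat) (m l : shape) : F :=
  \sum_(S : {set cell}) layer_transfer i (m, set0) (l, S).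

(** The transfer weight depends on the previous layer only through its shape, so the sets of cells
    can be summed out. *)
Lemma chainv_shape i l :
  \sum_(S : {set cell}) chainv (empty, set0) layer_transfer i (l, S) =
  chainv empty shape_transfer i l.
Proof.
elim: i l => [|i IH] l /=.
  rewrite (bigD1 set0) //= xpair_eqE eqxx andbT big1 ?addr0 // => S /negbTE S0.
  by rewrite xpair_eqE S0 andbF.
rewrite exchange_big /=.
transitivity (\sum_(s : layer) chainv (empty, set0) layer_transfer i (s.1, s.2) * shape_transfer i s.1 l).
  by apply: eq_bigr => [[m S]] _; rewrite -big_distrr.
rewrite -(pair_bigA _ (fun m S => chainv (empty, set0) layer_transfer i (m, S) * shape_transfer i m l)) /=.
by apply: eq_bigr => m _; rewrite -IH big_distrl.
Qed.

Hypotheses (u0 : u != 0) (v0 : v != 0) (w0 : w != 0).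

(** Weight, without w, of a row r with l cells each holding one y: u for each cell above the
    diagonal, v for each of the r + 1 other places left empty. *)
Definition row_wt (y : F) (r l : nat) : F := u ^+ (l - r.+1) * y ^+ l * v ^+ (r.+1 - l).

Lemma row_wt_neq0 y r l : y != 0 -> row_wt y r l != 0.
Proof. by move=> y0; rewrite !mulf_neq0 ?expf_neq0. Qed.

Lemma row_wtS y r c : y != 0 -> row_wt y r c.+1 / row_wt y r c = y * (if (c <= r)%N then v^-1 else u).
Proof.
move=> y0; have Yc := expf_neq0 c y0; rewrite /row_wt; case: leqP => rc.
  have -> : (c.+1 - r.+1 = 0)%N by lia.
  have -> : (c - r.+1 = 0)%N by lia.
  have -> : (r.+1 - c = (r - c).+1)%N by lia.
  rewrite subSS !exprS expr0; have Vc := expf_neq0 (r - c) v0.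
  move: (y ^+ c) (v ^+ (r - c)) Yc Vc => a b a0 b0.
  by field; rewrite ?a0 ?b0 ?y0 ?oner_neq0 ?v0.
have -> : (r.+1 - c.+1 = 0)%N by lia.
have -> : (r.+1 - c = 0)%N by lia.
have -> : (c.+1 - r.+1 = (c - r.+1).+1)%N by lia.
rewrite !exprS expr0; have Uc := expf_neq0 (c - r.+1) u0.
move: (y ^+ c) (u ^+ (c - r.+1)) Yc Uc => a b a0 b0.
by field; rewrite ?a0 ?b0 ?oner_neq0.
Qed.

Lemma prod_ord_interval N (a b : nat) (G : nat -> F) : (b <= N)%N ->
  \prod_(c < N) (if (a <= c < b)%N then G c else 1) = \prod_(a <= c < b) G c.
Proof.
move=> bN; rewrite (big_nat_widen _ _ _ _ _ bN) big_geq_mkord /= [RHS]big_mkcond /=.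
by apply: eq_bigr => c _; rewrite andbC.
Qed.

(** The cells decide independently. A new cell must contain the value; an old one may contain it
    only on or below the diagonal and with no cell of [l] beneath it, and this free choice gives
    [q]. Truncated subtraction in the exponents of [q] counts just the columns up to the
    diagonal. *)
Lemma shape_transferE i (m l : shape) (q := 1 + Y i * w / v) :
  Y i != 0 -> q != 0 -> interlace m l ->
  shape_transfer i m l = v ^+ i.+1 *
    \prod_(r < n) (row_wt (Y i) r (l r) / row_wt (Y i) r (m r) *
                   (q ^+ (r.+1 - part l r.+1) / q ^+ (r.+1 - m r))).
Proof.
move=> y0 q0 ml; rewrite /shape_transfer /layer_transfer /= ml.
under eq_bigr do rewrite mul1r.
rewrite -big_distrr /=; congr (_ * _).
pose cw p b := (layer_cell m l p b)%:R * layer_cell_weight (Y i) m l p b.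
transitivity (\prod_p (cw p true + cw p false)).
  by rewrite bigA_distr; apply: eq_bigr => S _; apply: eq_bigr => p _; case: (p \in S).
rewrite -(pair_bigA _ (fun r c => cw (r, c) true + cw (r, c) false)) /=; apply: eq_bigr => r _.
have /andP[lm mlr] : (part l r.+1 <= m r <= l r)%N by move/forallP/(_ r): ml.
rewrite -(prod_telescope (G := row_wt (Y i) r)) ?mlr //; last by move=> k; apply: row_wt_neq0.
have -> : q ^+ (r.+1 - part l r.+1) / q ^+ (r.+1 - m r) =
   \prod_(part l r.+1 <= c < m r) (if (c <= r)%N then q else 1).
  have -> : q ^+ (r.+1 - part l r.+1) / q ^+ (r.+1 - m r)
          = q ^- (r.+1 - m r) / q ^- (r.+1 - part l r.+1) by rewrite invrK mulrC.
  rewrite -(prod_telescope (G := fun c => q ^- (r.+1 - c))) //; last first.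
    by move=> k; rewrite invr_neq0 // expf_neq0.
  apply: eq_bigr => c _; rewrite invrK; case: leqP => rc.
    have -> : (r.+1 - c = (r.+1 - c.+1).+1)%N by lia.
    by rewrite exprS mulrC mulfK // expf_neq0.
  have -> : (r.+1 - c = 0)%N by lia.
  have -> : (r.+1 - c.+1 = 0)%N by lia.
  by rewrite expr0 invr1 mulr1.
have lN : (l r <= n.+1)%N by rewrite -ltnS.
rewrite -(prod_ord_interval _ _ lN) -(prod_ord_interval _ _ (leq_trans mlr lN)) -big_split.
apply: eq_bigr => c _ /=; rewrite /cw /layer_cell /layer_cell_weight /in_shape /= row_wtS //.
have k0 : cell_coef (r, c) != 0 by rewrite /cell_coef mulf_neq0 ?invr_neq0 //; case: ifP; rewrite ?oner_neq0.
case: (ltnP c (m r)) => cm.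
  rewrite (leq_trans cm mlr) /= andbT divff ?expf_neq0 // mulr1.
  rewrite !mul1r; case: (leqP c r) => cr; case: (leqP (part l r.+1) c) => lc /=;
    rewrite ?mul0r ?mul1r ?mulr1 ?add0r // /q; by field.
rewrite andbF mulr1 /=; case: (ltnP c (l r)) => cl /=; last by rewrite mul0r add0r !expr0 divr1 !mul1r.
rewrite !mul0r addr0 mul1r expr0 expr1 divr1 /cell_coef /=.
by case: leqP => cr; field; rewrite ?v0 ?w0.
Qed.

Lemma phi_row i j l y (q := 1 + y * w / v) : (j <= i)%N ->
  phi u v w i.+1 (l + (i - j)) y = row_wt y j l * y ^+ (i - j) * q ^+ (j - l).
Proof.
move=> ji; rewrite /phi /row_wt exprD; case: ltnP => lj /=.
  have -> : (l - j.+1 = 0)%N by lia.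
  have -> : (i - (l + (i - j)) = j - l)%N by lia.
  have -> : (j.+1 - l = (j - l).+1)%N by lia.
  have -> : v + w * y = v * q by rewrite /q; field.
  by rewrite exprMn exprS expr0; move: (_ ^+ _) (_ ^+ _) => a b; ring.
have -> : (j.+1 - l = 0)%N by lia.
have -> : (j - l = 0)%N by lia.
have -> : (l + (i - j) - i.+1 = l - j.+1)%N by lia.
by rewrite !expr0 !mulr1 mulrA.
Qed.

Lemma kap_row i j m y (q := 1 + y * w / v) : (j < i)%N ->
  kap u v w i (m + (i.-1 - j)) y = (row_wt y j m)^-1 * y ^- (i - j) * q ^- (j.+1 - m).
Proof.
move=> ji; rewrite /kap /row_wt.
have -> : ((m + (i.-1 - j)).+1 = m + (i - j))%N by lia.
rewrite exprD !invfM; case: (leqP (m + (i - j)) i) => mj.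
  have -> : (m - j.+1 = 0)%N by lia.
  have -> : (i - (m + (i.-1 - j)) = j.+1 - m)%N by lia.
  have -> : v + w * y = v * q by rewrite /q; field.
  by rewrite exprMn invfM expr0 invr1 mul1r; ring.
have -> : (j.+1 - m = 0)%N by lia.
have -> : (m + (i.-1 - j) - i = m - j.+1)%N by lia.
by rewrite !expr0 invr1 !mulr1 mulrA.
Qed.

Lemma part_padf i (k : 'I_i -> 'I_n.+2) (b : 'I_i) : (i <= n)%N ->
  part (padf ord0 n k) b = k b.
Proof.
move=> le_in; rewrite /part (insubT (fun j => j < n)%N (leq_trans (ltn_ord b) le_in)) /=.
by rewrite (padf_lt _ _ (b := b)).
Qed.

Lemma part_padf0 i (k : 'I_i -> 'I_n.+2) (j : nat) : (i <= j)%N ->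
  part (padf ord0 n k) j = 0%N.
Proof. by move=> ij; rewrite /part; case: insubP => // b _ Eb; rewrite padf_ge // Eb. Qed.

Lemma part_val (l : shape) (r : 'I_n) : part l r = l r.
Proof. by rewrite /part (valK r). Qed.

Lemma chainv_shape_supp i (l : shape) : ~~ [forall j : 'I_n, (i <= j)%N ==> (l j == ord0)] ->
  chainv empty shape_transfer i l = 0.
Proof.
elim: i l => [|i IH] l /=.
  move=> /forallPn [j] /= lj; case: eqP => // El.
  by rewrite El ffunE eqxx in lj.
move=> nl; apply: big1 => m _.
case: (boolP [forall j : 'I_n, (i <= j)%N ==> (m j == ord0)]) => [/forallP m0|/IH ->]; last by rewrite mul0r.
rewrite /shape_transfer big1 ?mulr0 // => S _; rewrite /layer_transfer /=.
case: (boolP (interlace m l)) => [/forallP ml|_]; last by rewrite mul0r.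
case/negP: nl; apply/forallP=> j; apply/implyP=> ij; apply/eqP/val_inj => /=.
have [j' Ej] : exists j' : 'I_n, j = j'.+1 :> nat.
  have lt_j : (j.-1 < n)%N by rewrite (leq_ltn_trans (leq_pred _)).
  by exists (Ordinal lt_j); rewrite /= (ltn_predK ij).
have /andP[] := ml j'; rewrite -Ej part_val => le _.
have := m0 j'; rewrite -ltnS -Ej ij => /eqP E0; move: le; rewrite E0 /=.
by rewrite leqn0 => /eqP.
Qed.

Hypotheses (Y0 : forall i, Y i != 0) (Yq : forall i, v + w * Y i != 0).

Lemma row_wt0 y r : row_wt y r 0 = v ^+ r.+1.
Proof. by rewrite /row_wt subn0 sub0n !expr0 !mul1r. Qed.

(** Rows beyond i are empty in both shapes and contribute 1; row i is empty in [m], and its [row_wt]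
    cancels [v ^+ i.+1]. On the right the powers of y in [phi_row] and [kap_row] cancel, and the
    exponents j - l_j of [q], moved up by one row, become those of the layer. *)
Lemma layer_step_weight i (m l : nat -> nat) (y := Y i) (q := 1 + y * w / v) : (i < n)%N ->
  (forall j, (i <= j)%N -> m j = 0%N) -> (forall j, (i < j)%N -> l j = 0%N) ->
  v ^+ i.+1 * \prod_(r < n) (row_wt y r (l r) / row_wt y r (m r) *
                   (q ^+ (r.+1 - l r.+1) / q ^+ (r.+1 - m r))) =
  (\prod_(j < i.+1) phi u v w i.+1 (l j + (i - j)) y) *
  \prod_(j < i) kap u v w i (m j + (i.-1 - j)) y.
Proof.
move=> lt_in m0 l0.
have y0 : y != 0 by apply: Y0.
have q0 : q != 0.
  have : v * q != 0 by rewrite (_ : v * q = v + w * y) ?Yq // /q; field.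
  by apply: contra_neq => ->; rewrite mulr0.
pose g r := row_wt y r (l r) / row_wt y r (m r) * (q ^+ (r.+1 - l r.+1) / q ^+ (r.+1 - m r)).
rewrite -(big_mkord xpredT g) (big_cat_nat (n := i.+1)) //= [X in _ * (_ * X)]big_nat_cond.
rewrite [X in _ * (_ * X)]big1 => [|r]; last first.
  rewrite andbT => /andP[ir _]; rewrite /g (m0 r) 1?ltnW // (l0 r) // (l0 r.+1) 1?ltnW //.
  by rewrite !divff ?mulr1 // ?expf_neq0 // row_wt_neq0.
rewrite mulr1 big_nat_recr //= big_mkord.
have -> : g i = row_wt y i (l i) / v ^+ i.+1.
  rewrite /g (m0 i) // (l0 i.+1) // divff ?mulr1 ?expf_neq0 //.
  by rewrite row_wt0.
have -> : \prod_(j < i.+1) phi u v w i.+1 (l j + (i - j)) y =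
   (\prod_(j < i) row_wt y j (l j)) * row_wt y i (l i) * (\prod_(j < i) y ^+ (i - j)) *
   \prod_(j < i) q ^+ (j.+1 - l j.+1).
  under eq_bigr => j _ do rewrite phi_row -1?ltnS //.
  rewrite big_split [X in X * _ = _]big_split /=; congr (_ * _ * _).
  - by rewrite big_ord_recr /=.
  - by rewrite big_ord_recr /= subnn expr0 mulr1.
  - by rewrite big_ord_recl /= sub0n expr0 mul1r.
under [X in _ = _ * X]eq_bigr => j _ do rewrite kap_row //.
have -> : \prod_(j < i) g j = (\prod_(j < i) row_wt y j (l j)) * (\prod_(j < i) row_wt y j (m j))^-1 *
   ((\prod_(j < i) q ^+ (j.+1 - l j.+1)) * (\prod_(j < i) q ^+ (j.+1 - m j))^-1).
  by rewrite -!prodfV -!big_split.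
have -> : \prod_(j < i) ((row_wt y j (m j))^-1 * y ^- (i - j) * (1 + y * w / v) ^- (j.+1 - m j)) =
   (\prod_(j < i) row_wt y j (m j))^-1 * (\prod_(j < i) y ^+ (i - j))^-1 *
   (\prod_(j < i) q ^+ (j.+1 - m j))^-1.
  by rewrite -!prodfV -!big_split.
have Yp : \prod_(j < i) y ^+ (i - j) != 0 by apply/prodf_neq0 => j _; apply: expf_neq0.
have V := expf_neq0 i.+1 v0.
move: (\prod_(j < i) y ^+ _) Yp => a a0.
move: (\prod_(j < i) row_wt y j (l j)) (\prod_(j < i) row_wt y j (m j)) => b c.
move: (\prod_(j < i) q ^+ (j.+1 - l j.+1)) (\prod_(j < i) q ^+ (j.+1 - m j)) => d e.
move: (v ^+ i.+1) V (row_wt _ _ _) => f f0 h.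
transitivity (b * c^-1 * (d * e^-1) * h * (f / f)); first by ring.
transitivity (b * c^-1 * (d * e^-1) * h * (a / a)); first by rewrite !divff.
by ring.
Qed.

(** Adding a layer is the branching rule with y = Y_i. The rule yields factors Y_a - Y_i where the
    Vandermonde product has Y_i - Y_a, whence the sign. *)
Lemma shape_gf_det i (k : {ffun 'I_i -> 'I_n.+2}) : (i <= n)%N ->
  (forall b b' : 'I_i, b' = b.+1 :> nat -> (k b' <= k b)%N) ->
  (\prod_(a < i) (-1) ^+ a) * (vdm Y i * chainv empty shape_transfer i (padf ord0 n k)) =
  \det (phi_mx u v w (fun j => k j) (fun a : 'I_i => Y a)).
Proof.
elim: i k => [|i IH] k le_in k_dec.
  rewrite det_mx00 /vdm !big_ord0 !mul1r /= (_ : _ == _) //.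
  by apply/eqP/ffunP=> j; rewrite padf_ge // ffunE.
set l := padf ord0 n k.
have lE (b : 'I_i.+1) : part l b = k b by apply: part_padf.
have l_dec j : (j < i)%N -> (part l j.+1 <= part l j < n.+2)%N.
  move=> ji; have j1 : (j < i.+1)%N := leqW ji.
  have := lE (Ordinal j1); have := lE (Ordinal (ji : (j.+1 < i.+1)%N)) => /= -> ->.
  by rewrite ltn_ord andbT k_dec.
have -> : phi_mx u v w (fun j : 'I_i.+1 => k j) (fun a : 'I_i.+1 => Y a) =
   phi_mx u v w (fun j : 'I_i.+1 => part l j) (extend (fun a : 'I_i => Y a) (Y i)).
  apply/matrixP=> j a; rewrite !mxE lE; congr phi.
  by rewrite /extend; case: unliftP => [b ->|->] //=; rewrite /bump leqNgt ltn_ord.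
rewrite (phi_branching u0 v0 _ (Y0 i) (Yq i) l_dec) vdmS big_ord_recr /=.
have -> : \prod_(a < i) (Y i - Y a) = (-1) ^+ i * \prod_(a < i) (Y a - Y i).
  rewrite -[in (-1) ^+ i](card_ord i) -prodrN; apply: eq_bigr => a _.
  by rewrite opprB.
rewrite (sum_padf (e0 := ord0) (ltnW le_in)); last by move=> m nm; rewrite chainv_shape_supp ?mul0r.
rewrite !big_distrr [RHS]big_mkcond /=; apply: eq_bigr => m _.
set pm := padf ord0 n m.
have mE (b : 'I_i) : part pm b = m b by apply: part_padf; apply: ltnW.
have m0 j : (i <= j)%N -> part pm j = 0%N by apply: part_padf0.
have l0 j : (i < j)%N -> part l j = 0%N by apply: part_padf0.
have interlaceE : interlace pm l = [forall j : 'I_i, (part l j.+1 <= m j <= part l j)%N].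
  apply/forallP/forallP => H j.
    have := H (widen_ord (ltnW le_in) j); rewrite -!part_val /= mE //.
  rewrite -!part_val; case: (ltnP j i) => ji.
    by have := H (Ordinal ji); rewrite -mE.
  by rewrite m0 // l0.
case: ifP => cm; last first.
  have -> : shape_transfer i pm l = 0; last by rewrite !mulr0.
  by apply: big1 => S _; rewrite /layer_transfer /= interlaceE cm mul0r.
have q0 : 1 + Y i * w / v != 0.
  have : v * (1 + Y i * w / v) != 0 by rewrite (_ : _ * _ = v + w * Y i) ?Yq //; field.
  by apply: contra_neq => ->; rewrite mulr0.
rewrite shape_transferE ?interlaceE //.
have := layer_step_weight le_in m0 l0.
under [in X in _ = _ * X]eq_bigr => j _ do rewrite mE.
move=> step.
rewrite (_ : \prod_(r < n) _ = \prod_(r < n) (row_wt (Y i) r (part l r) / row_wt (Y i) r (part pm r) *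
  ((1 + Y i * w / v) ^+ (r.+1 - part l r.+1) / (1 + Y i * w / v) ^+ (r.+1 - part pm r)))); last first.
  by apply: eq_bigr => r _; rewrite !part_val.
rewrite step -IH ?(ltnW le_in) // => [|b b' bb']; last first.
  have /andP[h1 _] := forallP cm b; have /andP[_ h2] := forallP cm b'.
  by apply: leq_trans h1; rewrite -bb'.
have S : (-1) ^+ i * (-1) ^+ i = 1 :> F by rewrite -expr2 sqrr_sign.
rewrite -/pm; move: (chainv _ _ _ _) (vdm Y i) (\prod_(a < i) (Y a - Y i)) (\prod_(a < i) (-1) ^+ a).
move: (\prod_(j < i) kap _ _ _ _ _ _) (\prod_(j < i.+1) phi _ _ _ _ _ _) ((-1) ^+ i) S.
move=> a b s S c d e f.
transitivity ((s * s) * (f * (d * e * (c * (b * a))))); first by ring.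
by rewrite S; ring.
Qed.

End Layers.

(** * Fillings as chains of layers *)

Lemma card_ord_lt N a : (a <= N)%N -> #|[set c : 'I_N | (c < a)%N]| = a.
Proof.
move=> aN; rewrite -sum1_card (eq_bigl (fun c : 'I_N => (c < a)%N)) => [|c]; last by rewrite inE.
by rewrite (big_ord_narrow aN) sum1_card card_ord.
Qed.

Lemma mem_initial_segment N (A : {set 'I_N}) (c : 'I_N) :
  (forall a b : 'I_N, b = a.+1 :> nat -> b \in A -> a \in A) ->
  (c \in A) = (c < #|A|)%N.
Proof.
move=> dA.
have down d : forall (a b : 'I_N), (b = a + d :> nat)%N -> b \in A -> a \in A.
  elim: d => [|d IH] a b; first by rewrite addn0 => /val_inj ->.
  move=> Eb bA; have lt_d : (a + d < N)%N by rewrite (leq_ltn_trans _ (ltn_ord b)) // Eb addnS.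
  by apply: (IH a (Ordinal lt_d)) => //; apply: dA bA; rewrite Eb addnS.
apply/idP/idP => [cA|].
  rewrite -[c.+1](@card_ord_lt N) ?ltn_ord // subset_leq_card //.
  by apply/subsetP=> a; rewrite inE ltnS => ac; apply: (down (c - a)%N a c) => //; rewrite subnKC.
apply: contraLR => cA; rewrite -leqNgt.
apply: leq_trans (_ : #|A| <= #|[set a : 'I_N | (a < c)%N]|)%N _; last by rewrite card_ord_lt // ltnW.
apply/subset_leq_card/subsetP=> a aA; rewrite inE ltnNge; apply: contra cA => ca.
by apply: (down (a - c)%N c a) => //; rewrite subnKC.
Qed.

Section Fillings.
Variable n : nat.
Local Notation shape := {ffun 'I_n -> 'I_n.+2}.
Local Notation cell := ('I_n * 'I_n.+1)%type.
Local Notation layer := (shape * {set cell})%type.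
Local Notation empty := ([ffun=> ord0] : shape).
Local Notation lay0 := ((empty, set0) : layer).
Implicit Types (D : sbcspp n) (f : {ffun 'I_n -> layer}).

(** Near-balancedness depends on the final shape alone and is split off; what is left can be checked
    on consecutive layers. *)
Definition cspp D : bool :=
  [&& [forall r : 'I_n, forall r' : 'I_n, forall c : 'I_n.+1, forall c' : 'I_n.+1,
         [&& (r' <= r)%N, (c' <= c)%N & inshape D (r, c)] ==> inshape D (r', c')],
      [forall r : 'I_n, forall c : 'I_n.+1,
         ((r < c)%N && inshape D (r, c)) ==> (#|D (r, c)| == 1%N)],
      [forall r : 'I_n, forall c : 'I_n.+1, forall c' : 'I_n.+1,
         [&& val c' == c.+1, inshape D (r, c) & inshape D (r, c')] ==>
         (setmax (D (r, c')) <= setmax (D (r, c)))%N]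
    & [forall r : 'I_n, forall r' : 'I_n, forall c : 'I_n.+1,
         (val r' == r.+1) ==>
         [forall x in D (r, c), forall y in D (r', c), (y < x)%N]]].

Definition near_balanced D : bool :=
  [forall i : 'I_n, ondiag D i ==> ((arm D i == leg D i) || (arm D i == (leg D i).+1))].

Lemma is_sbcsppE D : is_sbcspp D = cspp D && near_balanced D.
Proof.
rewrite /is_sbcspp /cspp -/(near_balanced D).
by case: (near_balanced D); rewrite ?andbT ?andbF ?andTb ?andFb ?andbF.
Qed.

Definition layer_ok (m : shape) (t : layer) : bool :=
  interlace m t.1 && [forall p, layer_cell m t.1 p (p \in t.2)].

Definition layers_ok f : bool := [forall i : 'I_n, layer_ok (prevf lay0 f i).1 (f i)].

Definition covered f (k : nat) (p : cell) : bool :=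
  [exists i : 'I_n, (i < k)%N && (p \in (f i).2)].

(* Step [i] of a chain of layers handles the value [n - 1 - i]: the largest values
   come first. *)
Definition fill_of f : sbcspp n := [ffun p => [set k : 'I_n | p \in (f (rev_ord k)).2]].

Definition layer_of D (i : 'I_n) : {set cell} := [set p | rev_ord i \in D p].

Definition covered_by D (k : nat) (p : cell) : bool :=
  [exists i : 'I_n, (i < k)%N && (p \in layer_of D i)].

Definition layers_of D : {ffun 'I_n -> layer} :=
  [ffun i : 'I_n => ([ffun r : 'I_n => inord #|[set c | covered_by D i.+1 (r, c)]|], layer_of D i)].

Lemma mem_fill f p k : (k \in fill_of f p) = (p \in (f (rev_ord k)).2).
Proof. by rewrite ffunE inE. Qed.

Lemma prevf_ord (T : finType) (t0 : T) (f : {ffun 'I_n -> T}) (i : 'I_n) k :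
  k = i.+1 -> prevf t0 f k = f i.
Proof. by move=> ->; rewrite /= (valK i). Qed.

Lemma in_shape_empty p : in_shape empty p = false.
Proof. by rewrite /in_shape ffunE. Qed.

Lemma in_shape_interlace (m l : shape) p : interlace m l -> in_shape m p -> in_shape l p.
Proof. by move=> /forallP/(_ p.1)/andP[_ le] lt; apply: leq_trans lt le. Qed.

Section Valid.
Variable f : {ffun 'I_n -> layer}.
Hypothesis f_ok : layers_ok f.

(** A cell can join the shape only at a step whose layer contains it, so the layers determine the
    shapes. *)
Lemma in_shape_covered k p : (k <= n)%N -> in_shape (prevf lay0 f k).1 p = covered f k p.
Proof.
elim: k => [|k IH] kn.
  by rewrite in_shape_empty; apply/esym/existsP => -[i]; rewrite ltn0.
pose i := Ordinal kn; rewrite (@prevf_ord _ lay0 f i) //.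
have /andP[ml /forallP/(_ p)] := forallP f_ok i.
rewrite /layer_cell; case: (boolP (p \in (f i).2)) => [pS /andP[-> _]|npS].
  by apply/esym/existsP; exists i; rewrite ltnSn pS.
rewrite [X in prevf _ _ X]/= => lm.
have -> : in_shape (f i).1 p = in_shape (prevf lay0 f k).1 p.
  by apply/idP/idP => [|/(in_shape_interlace ml) //]; apply: (implyP lm).
rewrite IH 1?ltnW //; apply/existsP/existsP => -[j /andP[jk pj]]; exists j; rewrite pj andbT.
  exact: leqW.
move: jk; rewrite ltnS leq_eqVlt => /orP[/eqP jk|//].
by case/negP: npS; rewrite (_ : i = j) //; apply: val_inj.
Qed.

Lemma in_shape_f (i : 'I_n) p : in_shape (f i).1 p = covered f i.+1 p.
Proof. by rewrite -(prevf_ord lay0 f (erefl i.+1)) in_shape_covered. Qed.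

Lemma inshape_fill p : inshape (fill_of f) p = in_shape (prevf lay0 f n).1 p.
Proof.
rewrite in_shape_covered //; apply/set0Pn/existsP => [[k]|[i /andP[_ pi]]].
  by rewrite mem_fill => pk; exists (rev_ord k); rewrite ltn_ord.
by exists (rev_ord i); rewrite mem_fill rev_ordK.
Qed.

Lemma prevf_shape_dec k (r r' : 'I_n) : (k <= n)%N -> (r <= r')%N ->
  ((prevf lay0 f k).1 r' <= (prevf lay0 f k).1 r)%N.
Proof.
move=> kn rr'; have [d Ed] : exists d, r' = (r + d)%N :> nat by exists (r' - r)%N; rewrite subnKC.
elim: d r' Ed rr' => [|d IH] r' Ed rr'.
  by rewrite (_ : r' = r) //; apply: val_inj; rewrite /= Ed addn0.
have lt_d : (r + d < n)%N by rewrite (leq_ltn_trans _ (ltn_ord r')) // Ed addnS.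
apply: leq_trans (IH (Ordinal lt_d) erefl (leq_addr _ _)).
case: k kn {IH} => [|k] kn; first by rewrite !ffunE.
rewrite (@prevf_ord _ lay0 f (Ordinal kn)) //.
have /andP[/forallP/(_ (Ordinal lt_d))/andP[h1 h2] _] := forallP f_ok (Ordinal kn).
by apply: leq_trans h2; apply: leq_trans h1; rewrite -part_val Ed addnS.
Qed.

Lemma cspp_fill : cspp (fill_of f).
Proof.
have cellP (i : 'I_n) p : p \in (f i).2 ->
    in_shape (f i).1 p && (in_shape (prevf lay0 f i).1 p ==> (p.2 <= p.1)%N && (part (f i).1 p.1.+1 <= p.2)%N).
  by move=> pi; have /andP[_ /forallP/(_ p)] := forallP f_ok i; rewrite /layer_cell pi.
apply/and4P; split.
- apply/forallP=> r; apply/forallP=> r'; apply/forallP=> c; apply/forallP=> c'; apply/implyP=> /and3P[rr cc].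
  rewrite !inshape_fill /in_shape /= => h.
  by apply: leq_ltn_trans cc _; apply: leq_trans h _; apply: prevf_shape_dec.
- apply/forallP=> r; apply/forallP=> c; apply/implyP=> /andP[rc ne].
  (* The larger value is handled first, so the smaller one would enter an old cell, which is allowed
     only on or below the diagonal. *)
  have uniq_el (k k' : 'I_n) : (k < k')%N -> k \in fill_of f (r, c) -> k' \in fill_of f (r, c) -> False.
    rewrite !mem_fill => kk' pk pk'.
    have /andP[_ /implyP h] := cellP _ _ pk.
    have /h /andP[cr _] : in_shape (prevf lay0 f (rev_ord k)).1 (r, c).
      rewrite in_shape_covered 1?ltnW //; apply/existsP; exists (rev_ord k'); rewrite pk' andbT /=.
      by have := ltn_ord k'; lia.
    by move: rc; rewrite ltnNge cr.
  case/set0Pn: ne => k kD; apply/cards1P; exists k; apply/setP=> k'; rewrite inE.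
  apply/idP/eqP => [k'D|->//]; apply: val_inj; case: (ltngtP k k') => // lt; exfalso.
    exact: uniq_el lt kD k'D.
  exact: uniq_el lt k'D kD.
- apply/forallP=> r; apply/forallP=> c; apply/forallP=> c'; apply/implyP=> /and3P[/eqP Ec _ _].
  apply/bigmax_leqP => k; rewrite mem_fill => pk.
  have /andP[sk _] := cellP _ _ pk.
  have : in_shape (f (rev_ord k)).1 (r, c) by apply: ltn_trans sk; rewrite /= [nat_of_ord c']Ec.
  rewrite in_shape_f => /existsP[i /andP[ik pi]].
  apply: (@leq_trans (rev_ord i)); first by move: ik; rewrite /=; have := ltn_ord k; have := ltn_ord i; lia.
  by apply: leq_bigmax_cond; rewrite mem_fill rev_ordK.
apply/forallP=> r; apply/forallP=> r'; apply/forallP=> c; apply/implyP=> /eqP Er.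
apply/forallP=> k; apply/implyP=> kD; apply/forallP=> k'; apply/implyP=> k'D.
rewrite ltnNge; apply/negP => kk'; rewrite !mem_fill in kD k'D.
(* If k <= k', the lower cell belongs to the new shape at the step of k, so by interlacing the upper
   cell belongs to the old one; k may then enter it only if no cell of the new shape lies beneath, a
   contradiction. *)
have cov : in_shape (f (rev_ord k)).1 (r', c).
  rewrite in_shape_f; apply/existsP; exists (rev_ord k'); rewrite k'D andbT /=.
  by have := ltn_ord k'; lia.
have /andP[/forallP/(_ r)/andP[h1 h2] _] := forallP f_ok (rev_ord k).
have /andP[_ /implyP h] := cellP _ _ kD.
have lt_c : (c < part (f (rev_ord k)).1 r.+1)%N by move: cov; rewrite /in_shape -part_val /= [nat_of_ord r']Er.
have /h /andP[_] : in_shape (prevf lay0 f (rev_ord k)).1 (r, c) by apply: leq_trans lt_c h1.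
by rewrite leqNgt lt_c.
Qed.

Lemma layers_fill : layers_of (fill_of f) = f.
Proof.
have layE i : layer_of (fill_of f) i = (f i).2.
  by apply/setP=> p; rewrite inE mem_fill rev_ordK.
apply/ffunP=> i; rewrite ffunE layE; case E: (f i) => [l S] /=; congr (_, _).
apply/ffunP=> r; rewrite ffunE; apply: val_inj => /=.
have -> : [set c | covered_by (fill_of f) i.+1 (r, c)] = [set c : 'I_n.+1 | (c < l r)%N].
  apply/setP=> c; rewrite !inE -[RHS]/(in_shape l (r, c)) -[l]/((l, S).1) -E in_shape_f.
  by apply: eq_existsb => j; rewrite layE.
by rewrite card_ord_lt ?inordK // -ltnS.
Qed.
End Valid.

Lemma fill_layers D : fill_of (layers_of D) = D.
Proof. by apply/ffunP=> p; apply/setP=> k; rewrite mem_fill ffunE inE rev_ordK. Qed.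

Lemma layers_ok_of D : cspp D -> layers_ok (layers_of D).
Proof.
case/and4P=> /forallP c1 /forallP c2 /forallP c3 /forallP c4.
have C1 (r r' : 'I_n) (c c' : 'I_n.+1) : (r' <= r)%N -> (c' <= c)%N -> inshape D (r, c) -> inshape D (r', c').
  move=> h1 h2 h3; move/forallP/(_ r')/forallP/(_ c)/forallP/(_ c')/implyP: (c1 r).
  by apply; apply/and3P.
have C2 (r : 'I_n) (c : 'I_n.+1) (k k' : 'I_n) : (r < c)%N -> k \in D (r, c) -> k' \in D (r, c) -> k = k'.
  move=> rc kD; move/forallP/(_ c)/implyP: (c2 r); rewrite rc /=.
  have -> : inshape D (r, c) by apply/set0Pn; exists k.
  by move=> /(_ isT)/cards1P[x Ex]; move: kD; rewrite Ex !inE => /eqP -> /eqP ->.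
have C3 (r : 'I_n) (c c' : 'I_n.+1) (k : 'I_n) : c' = c.+1 :> nat -> k \in D (r, c') -> exists2 k', k' \in D (r, c) & (k <= k')%N.
  move=> Ec kD; have ne' : inshape D (r, c') by apply/set0Pn; exists k.
  have ne : inshape D (r, c) by apply: C1 ne'; rewrite ?Ec.
  move/forallP/(_ c)/forallP/(_ c')/implyP: (c3 r); rewrite /= Ec eqxx ne ne' => /(_ isT) le.
  have [k' k'D Ek'] : exists2 k', k' \in D (r, c) & setmax (D (r, c)) = k' :> nat.
    rewrite /setmax; case/set0Pn: ne => x0 x0D.
    rewrite (bigop.bigmax_eq_arg x0) //; case: arg_maxnP => // k' k'D _.
    by exists k'.
  exists k' => //; rewrite -Ek'; apply: leq_trans le; rewrite /setmax.
  exact: (leq_bigmax_cond (F := fun x : 'I_n => val x)).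
have C4 (r r' : 'I_n) (c : 'I_n.+1) (k k' : 'I_n) : r' = r.+1 :> nat -> k \in D (r, c) -> k' \in D (r', c) -> (k' < k)%N.
  move=> Er kD k'D; move/forallP/(_ r')/forallP/(_ c)/implyP: (c4 r); rewrite /= Er eqxx.
  by move=> /(_ isT)/forallP/(_ k)/implyP/(_ kD)/forallP/(_ k')/implyP; apply.
(* By [C3], a cell whose right neighbour is covered is covered too; the covered cells of a row form
   an initial segment, and their number is its length. *)
have in_shapeE (i : 'I_n) p : in_shape (layers_of D i).1 p = covered_by D i.+1 p.
  case: p => r c; rewrite /in_shape !ffunE /= inordK; last first.
    by rewrite ltnS (leq_trans (max_card _)) // card_ord.
  rewrite -mem_initial_segment ?inE // => a b Eb; rewrite !inE => /existsP[j /andP[ji]].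
  rewrite inE => jD; have [k' k'D le] := C3 _ _ _ _ Eb jD.
  apply/existsP; exists (rev_ord k'); rewrite inE rev_ordK k'D andbT.
  by move: le ji => /=; have := ltn_ord j; have := ltn_ord k'; lia.
have prevE (i : 'I_n) p : in_shape (prevf lay0 (layers_of D) i).1 p = covered_by D i p.
  case: i => [[|i] lt_i].
    by rewrite in_shape_empty; apply/esym/existsP => -[j]; rewrite ltn0.
  by rewrite (@prevf_ord _ lay0 (layers_of D) (Ordinal (ltnW lt_i))) // in_shapeE.
have le_of_sub (l m : shape) (r r' : 'I_n) :
    (forall c : 'I_n.+1, in_shape l (r', c) -> in_shape m (r, c)) -> (l r' <= m r)%N.
  move=> sub; rewrite leqNgt; apply/negP => lt.
  have lt_m : (m r < n.+1)%N by apply: leq_trans lt _; rewrite -ltnS.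
  by have := sub (Ordinal lt_m); rewrite /in_shape /= ltnn => /(_ lt).
have cov_mono k k' p : (k <= k')%N -> covered_by D k p -> covered_by D k' p.
  move=> kk' /existsP[i /andP[ik pi]]; apply/existsP; exists i.
  by rewrite (leq_trans ik kk').
apply/forallP=> i; set m := (prevf lay0 (layers_of D) i).1.
apply/andP; split.
  apply/forallP=> r; apply/andP; split; last first.
    apply: le_of_sub => c; rewrite prevE in_shapeE; exact: cov_mono.
  rewrite /part; case: insubP => // r' _ Er; apply: le_of_sub => c; rewrite prevE in_shapeE.
  move=> /existsP[j /andP[ji]]; rewrite inE => jD.
  have : inshape D (r, c) by apply: (C1 r') => //; [rewrite Er | apply/set0Pn; exists (rev_ord j)].
  case/set0Pn=> k kD; have := C4 _ _ _ _ _ Er kD jD => lt.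
  apply/existsP; exists (rev_ord k); rewrite inE rev_ordK kD andbT.
  by move: ji lt => /=; have := ltn_ord j; have := ltn_ord k; lia.
apply/forallP=> p; rewrite /layer_cell prevE in_shapeE.
have -> : (p \in (layers_of D i).2) = (p \in layer_of D i) by rewrite ffunE.
case: (boolP (p \in layer_of D i)) => pi.
  apply/andP; split; first by apply/existsP; exists i; rewrite ltnSn pi.
  apply/implyP=> /existsP[j /andP[ji pj]]; case: p pi pj => r c; rewrite !inE /= => pi pj.
  apply/andP; split.
    rewrite leqNgt; apply/negP => rc; have := C2 _ _ _ _ rc pi pj.
    by move/rev_ord_inj => E; rewrite E ltnn in ji.
  rewrite leqNgt; apply/negP; rewrite /part; case: insubP => // r' _ Er lt_c.
  have : in_shape (layers_of D i).1 (r', c) by [].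
  rewrite in_shapeE => /existsP[i' /andP[ii']]; rewrite inE => i'D.
  have := C4 _ _ _ _ _ Er pi i'D.
  by move: ii' => /=; have := ltn_ord i; have := ltn_ord i'; lia.
apply/implyP=> /existsP[j /andP[ji pj]]; apply/existsP; exists j; rewrite pj andbT.
move: ji; rewrite ltnS leq_eqVlt => /orP[/eqP E|//].
by case/negP: pi; rewrite (_ : i = j) //; apply: val_inj.
Qed.

Lemma sum_cspp_layers (V : nmodType) (G : sbcspp n -> V) :
  \sum_(D | cspp D) G D = \sum_(f | layers_ok f) G (fill_of f).
Proof.
rewrite (reindex_onto fill_of layers_of) /=; last by move=> D _; apply: fill_layers.
apply: eq_bigl => f; apply/andP/idP => [[cf /eqP <-]|fok]; first exact: layers_ok_of.
by rewrite cspp_fill // layers_fill.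
Qed.

End Fillings.

Section ShapeStatistics.
Variable n : nat.
Local Notation shape := {ffun 'I_n -> 'I_n.+2}.

Definition shape_arm (l : shape) (i : 'I_n) : nat :=
  #|[set c : 'I_n.+1 | (i < c)%N && in_shape l (i, c)]|.
Definition shape_leg (l : shape) (i : 'I_n) : nat :=
  #|[set r : 'I_n | (i < r)%N && in_shape l (r, diagc i)]|.
Definition shape_nb (l : shape) : bool :=
  [forall i : 'I_n, in_shape l (i, diagc i) ==>
     ((shape_arm l i == shape_leg l i) || (shape_arm l i == (shape_leg l i).+1))].
Definition shape_nb_wexp (l : shape) : int :=
  #|[set i : 'I_n | in_shape l (i, diagc i)]|%:Z +
  \sum_(i : 'I_n | in_shape l (i, diagc i)) ((shape_leg l i)%:Z - (shape_arm l i)%:Z).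

Variables (D : sbcspp n) (l : shape).
Hypothesis Dl : forall p, inshape D p = in_shape l p.

Lemma arm_shape i : arm D i = shape_arm l i.
Proof. by apply: eq_card => c; rewrite !inE Dl. Qed.

Lemma leg_shape i : leg D i = shape_leg l i.
Proof. by apply: eq_card => c; rewrite !inE Dl. Qed.

Lemma near_balanced_shape : near_balanced D = shape_nb l.
Proof. by apply: eq_forallb => i; rewrite /ondiag Dl arm_shape leg_shape. Qed.

Lemma shape_wexp_shape : shape_wexp D = shape_nb_wexp l.
Proof.
rewrite /shape_wexp /shape_nb_wexp; congr (_ + _).
  by congr Posz; apply: eq_card => i; rewrite !inE /ondiag Dl.
by apply: eq_big => [i|i _]; rewrite ?/ondiag ?Dl // arm_shape leg_shape.
Qed.

End ShapeStatistics.

Section LayerWeights.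
Variables (F : fieldType) (u v w : F) (X : nat -> F) (n : nat).
Hypotheses (u0 : u != 0) (v0 : v != 0) (w0 : w != 0).
Local Notation shape := {ffun 'I_n -> 'I_n.+2}.
Local Notation cell := ('I_n * 'I_n.+1)%type.
Local Notation layer := (shape * {set cell})%type.
Local Notation empty := ([ffun=> ord0] : shape).
Local Notation lay0 := ((empty, set0) : layer).
Local Notation Y := (fun i : nat => X (n - i.+1)).

Lemma prod_indicator (I : finType) (P : pred I) (c : F) :
  \prod_i (if P i then c else 1) = c ^+ #|P|.
Proof. by rewrite -big_mkcond prodr_const. Qed.

Lemma prod_natr_forall (I : finType) (P : pred I) :
  \prod_i (P i)%:R = [forall i, P i]%:R :> F.
Proof.
case: (boolP [forall i, P i]) => [/forallP h|/forallPn[i /negbTE np]].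
  by rewrite big1 // => i _; rewrite h.
by rewrite (bigD1 i) //= np mul0r.
Qed.

(** The power of w attached to the shape is left out, as it depends on the final shape only. The
    order of the variables in [Y] is reversed because step i handles the value with index n - 1 -
    i. *)
Lemma sbcspp_weight_layers (f : {ffun 'I_n -> layer}) : layers_ok f ->
  let D := fill_of f in
  u ^+ cells_above D * v ^ (('C(n.+1, 2))%:Z - (entries_below D)%:Z) *
  w ^ ((entries D)%:Z - (cells D)%:Z) * \prod_(k : 'I_n) X k ^+ count_k D k =
  \prod_(i < n) (v ^+ i.+1 * \prod_p layer_cell_weight u v w (Y i)
     (prevf lay0 f i).1 (f i).1 p (p \in (f i).2)).
Proof.
move=> f_ok D.
rewrite big_split /=.
have -> : \prod_(i < n) v ^+ i.+1 = v ^+ 'C(n.+1, 2).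
  by rewrite prodrXr -bin2_sum big_mkord big_ord_recl add0n.
have -> : \prod_(i < n) \prod_p layer_cell_weight u v w (Y i) (prevf lay0 f i).1 (f i).1 p (p \in (f i).2)
   = (\prod_(i < n) \prod_p (if p \in (f i).2 then Y i else 1)) *
     (\prod_p \prod_(i < n) (if p \in (f i).2 then w else 1)) *
     (\prod_(p : cell | (p.2 <= p.1)%N) \prod_(i < n) (if p \in (f i).2 then v^-1 else 1)) *
     \prod_p \prod_(i < n) (cell_coef u w p ^+ in_shape (f i).1 p /
                            cell_coef u w p ^+ in_shape (prevf lay0 f i).1 p).
  rewrite [\prod_(p : cell | (p.2 <= p.1)%N) _]big_mkcond.
  rewrite [in LHS]exchange_big [X in _ = X * _ * _ * _]exchange_big -!big_split /=.
  apply: eq_bigr => p _; case: ifP => pd.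
    rewrite -!big_split; apply: eq_bigr => i _ /=; rewrite /layer_cell_weight pd.
    by case: ifP => _; rewrite ?mulr1.
  rewrite mulr1 -!big_split; apply: eq_bigr => i _ /=; rewrite /layer_cell_weight pd.
  by case: ifP => _; rewrite ?mulr1.
have -> : \prod_(i < n) \prod_p (if p \in (f i).2 then Y i else 1) = \prod_(k : 'I_n) X k ^+ count_k D k.
  rewrite [RHS](reindex_inj rev_ord_inj) /=; apply: eq_bigr => i _.
  rewrite prod_indicator; congr (_ ^+ _); apply: eq_card => p.
  by rewrite inE mem_fill rev_ordK.
have memD (c : F) p : \prod_(i < n) (if p \in (f i).2 then c else 1) = c ^+ #|D p|.
  rewrite (reindex_inj rev_ord_inj) /= prod_indicator; congr (_ ^+ _); apply: eq_card => k.
  by rewrite mem_fill.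
have -> : \prod_p \prod_(i < n) (if p \in (f i).2 then w else 1) = w ^+ entries D.
  by rewrite /entries -prodrXr; apply: eq_bigr => p _; apply: memD.
have -> : \prod_(p : cell | (p.2 <= p.1)%N) \prod_(i < n) (if p \in (f i).2 then v^-1 else 1)
    = v ^- entries_below D.
  by rewrite /entries_below -exprVn -prodrXr; apply: eq_bigr => p _; apply: memD.
have -> : \prod_p \prod_(i < n) (cell_coef u w p ^+ in_shape (f i).1 p /
                            cell_coef u w p ^+ in_shape (prevf lay0 f i).1 p) =
    u ^+ cells_above D * w ^- cells D.
  transitivity (\prod_p ((if inshape D p && (p.1 < p.2)%N then u else 1) * (if inshape D p then w^-1 else 1))).
    apply: eq_bigr => p _.
    pose G k := cell_coef u w p ^+ in_shape (prevf lay0 f k).1 p.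
    have c0 : cell_coef u w p != 0 by rewrite /cell_coef mulf_neq0 ?invr_neq0 //; case: ifP; rewrite ?oner_neq0.
    transitivity (\prod_(0 <= k < n) (G k.+1 / G k)).
      by rewrite big_mkord; apply: eq_bigr => i _; rewrite /G (prevf_ord lay0 f (erefl i.+1)).
    rewrite prod_telescope => [|k|//]; last by rewrite expf_neq0.
    rewrite /G in_shape_empty expr0 divr1 -inshape_fill // -/D /cell_coef ltnNge.
    by case: (inshape D p); case: (p.2 <= p.1)%N; rewrite /= ?expr0 ?expr1 ?mul1r.
  rewrite big_split /= !prod_indicator -exprVn.
  by congr (_ ^+ _ * _ ^+ _); apply: eq_card => p; rewrite inE.
rewrite !expfzDr // -!exprnP -!invr_expz -!exprnP.
move: (u ^+ _) (v ^+ _) (v ^- _) (w ^+ _) (w ^- _) (\prod_(k < n) _) => a b c d e g.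
by ring.
Qed.

Lemma sum_sbcspp_shapes :
  \sum_(D : sbcspp n | is_sbcspp D) sbcspp_weight u v w (fun k : 'I_n => X k) D =
  \sum_(l : shape | shape_nb l) w ^ shape_nb_wexp l * chainv empty (@shape_transfer _ u v w Y n) n l.
Proof.
pose W' (D : sbcspp n) := u ^+ cells_above D * v ^ (('C(n.+1, 2))%:Z - (entries_below D)%:Z) *
  w ^ ((entries D)%:Z - (cells D)%:Z) * \prod_(k : 'I_n) X k ^+ count_k D k.
pose g (l : shape) := (shape_nb l)%:R * w ^ shape_nb_wexp l.
transitivity (\sum_(D : sbcspp n | cspp D) (near_balanced D)%:R * w ^ shape_wexp D * W' D).
  rewrite big_mkcond [RHS]big_mkcond; apply: eq_bigr => D _; rewrite is_sbcsppE.
  case: (cspp D) => //=; case: (near_balanced D); rewrite ?mul1r ?mul0r //.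
  by rewrite /sbcspp_weight /W' !mulrA.
rewrite sum_cspp_layers.
transitivity (\sum_(f : {ffun 'I_n -> layer})
  (\prod_(i < n) @layer_transfer _ u v w Y n i (prevf lay0 f i) (f i)) * g (prevf lay0 f n).1).
  rewrite big_mkcond; apply: eq_bigr => f _.
  have ltE i s t : @layer_transfer _ u v w Y n i s t = (layer_ok s.1 t)%:R *
     (v ^+ i.+1 * \prod_p layer_cell_weight u v w (Y i) s.1 t.1 p (p \in t.2)).
    rewrite /layer_transfer /layer_ok big_split /= prod_natr_forall.
    by case: interlace; case: [forall p, _]; rewrite /= ?(mul0r, mulr0, mul1r).
  under [X in _ = X * _]eq_bigr => i _ do rewrite ltE.
  rewrite [X in _ = X * _]big_split /=.
  case: ifP => [fok|/negbT/forallPn[i /negbTE ni]]; last first.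
    by rewrite [X in X * _ * _](bigD1 i) //= ni !mul0r.
  rewrite [X in _ = X * _ * _]big1 ?mul1r => [|i _]; last by move/forallP/(_ i): fok => ->.
  rewrite -sbcspp_weight_layers // /W' /g.
  rewrite (near_balanced_shape (l := (prevf lay0 f n).1)); last by move=> p; apply: inshape_fill.
  rewrite (shape_wexp_shape (l := (prevf lay0 f n).1)); last by move=> p; apply: inshape_fill.
  by rewrite mulrC.
rewrite (chain_sum lay0 (@layer_transfer _ u v w Y n) n (fun t => g t.1)).
transitivity (\sum_(t : layer) chainv lay0 (@layer_transfer _ u v w Y n) n (t.1, t.2) * g t.1).
  by apply: eq_bigr => [[l S]].
rewrite -(pair_bigA _ (fun l S => chainv lay0 (@layer_transfer _ u v w Y n) n (l, S) * g l)) /=.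
rewrite [RHS]big_mkcond; apply: eq_bigr => l _.
rewrite -big_distrl /= chainv_shape /g mulrC.
by case: (shape_nb l); rewrite ?mul1r ?mul0r.
Qed.

End LayerWeights.

(** * Near-balanced shapes *)

Definition conj_part (s : seq nat) (i : nat) : nat := count (fun a => i < a)%N s.

Arguments conj_part : simpl never.

(** At a diagonal cell the arm is l_i - i - 1 and the leg is l'_i - i - 1, with l' the conjugate
    partition; comparing arm and leg amounts to comparing l_i and l'_i. *)
Definition nb_row (s : seq nat) (i : nat) : bool :=
  (i < nth 0%N s i)%N ==>
    ((nth 0%N s i == conj_part s i) || (nth 0%N s i == (conj_part s i).+1)).

Definition seq_nb (s : seq nat) : bool := all (nb_row s) (iota 0 (size s)).

(** For a near-balanced shape each diagonal cell contributes 1 + leg - arm to the exponent of w: 1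
    if arm and leg agree, 0 otherwise. *)
Definition seq_wexp (s : seq nat) : nat :=
  count (fun i => (i < nth 0 s i)%N && (nth 0%N s i == conj_part s i)) (iota 0 (size s)).

Lemma conj_part_rcons0 s i : conj_part (rcons s 0%N) i = conj_part s i.
Proof. by rewrite /conj_part -cats1 count_cat /= !addn0. Qed.

Lemma nth_rcons0 s i : nth 0%N (rcons s 0%N) i = nth 0%N s i.
Proof.
by rewrite nth_rcons; case: ltnP => // h; rewrite nth_default //; case: eqP.
Qed.

Lemma seq_nb_rcons0 s : seq_nb (rcons s 0%N) = seq_nb s.
Proof.
rewrite /seq_nb size_rcons -addn1 iotaD all_cat /= andbT add0n.
rewrite {2}/nb_row nth_rcons0 nth_default //= andbT.
by apply: eq_all => i; rewrite /nb_row nth_rcons0 conj_part_rcons0.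
Qed.

Lemma seq_wexp_rcons0 s : seq_wexp (rcons s 0%N) = seq_wexp s.
Proof.
rewrite /seq_wexp size_rcons -addn1 iotaD count_cat /= add0n nth_rcons0 nth_default //= !addn0.
by apply: eq_count => i; rewrite nth_rcons0 conj_part_rcons0.
Qed.

Lemma conj_part_cons0 s a : (0 < a)%N -> conj_part (a :: map S s) 0 = (size s).+1.
Proof.
move=> a0; rewrite /conj_part /= a0 add1n count_map -(count_predT s).
by congr _.+1; apply: eq_count.
Qed.

Lemma conj_part_consS s a i : (i.+1 < a)%N -> conj_part (a :: map S s) i.+1 = (conj_part s i).+1.
Proof. by move=> ia; rewrite /conj_part /= ia add1n count_map. Qed.

(** Adding an outer hook raises each l_i and l'_i by one and shifts the diagonal, so only the new
    corner brings a condition. The bound on a makes the new first row reach all the columns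
    inspected. *)
Lemma seq_nb_cons s a : (size s < a)%N ->
  seq_nb (a :: map S s) = ((a == (size s).+1) || (a == (size s).+2)) && seq_nb s.
Proof.
move=> sa; have a0 : (0 < a)%N by apply: leq_ltn_trans sa.
rewrite /seq_nb /= {1}/nb_row /= a0 /= conj_part_cons0 // size_map; congr (_ && _).
rewrite -[1%N]addn0 iotaDl all_map; apply: eq_in_all => i; rewrite mem_iota /= add0n => lt_i.
rewrite /nb_row /= add0n (nth_map 0%N) // conj_part_consS //.
exact: leq_ltn_trans lt_i sa.
Qed.

Lemma seq_wexp_cons s a : (size s < a)%N ->
  seq_wexp (a :: map S s) = ((a == (size s).+1) + seq_wexp s)%N.
Proof.
move=> sa; have a0 : (0 < a)%N by apply: leq_ltn_trans sa.
rewrite /seq_wexp /= a0 /= conj_part_cons0 // size_map; congr (_ + _)%N.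
rewrite -[1%N]addn0 iotaDl count_map; apply: eq_in_count => i; rewrite mem_iota /= add0n => lt_i.
rewrite /= add0n (nth_map 0%N) // conj_part_consS //.
exact: leq_ltn_trans lt_i sa.
Qed.

Lemma sorted_geq_rcons0 s : sorted geq (rcons s 0%N) = sorted geq s.
Proof.
case: s => //= a s; rewrite rcons_path /=; by rewrite andbT.
Qed.

Lemma sorted_geq_consS a s : sorted geq (a :: map S s) = ((s != [::]) ==> (head 0 s < a)%N) && sorted geq s.
Proof.
case: s => //= b s; rewrite path_map; congr (_ && _).
Qed.

Lemma seq_pos_cases (s : seq nat) : sorted geq s ->
  [\/ s = [::], exists t, s = rcons t 0%N | exists a t, s = a :: map S t /\ (0 < a)%N].
Proof.
case/lastP: s => [|s x]; first by constructor 1.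
case: x => [|x] sx; first by constructor 2; exists s.
constructor 3.
have pos y : y \in rcons s x.+1 -> (0 < y)%N.
  have tr : transitive geq by move=> a b c /= h1 h2; apply: leq_trans h2 h1.
  move: sx; rewrite (sorted_pairwise tr) pairwise_rcons => /andP[/allP h _].
  by rewrite mem_rcons inE => /orP[/eqP ->//|/h /=]; apply: leq_trans.
case E : (rcons s x.+1) pos => [|a t] pos; first by case: s E {sx}.
exists a, (map predn t); split; last by apply: pos; rewrite inE eqxx.
congr (_ :: _); rewrite -map_comp -[LHS]map_id; apply/eq_in_map => y yt /=.
by rewrite prednK // pos // inE yt orbT.
Qed.

Lemma mem_nbl m (p : nat * seq nat) :
  (p \in nbl m) = [&& size p.2 == m, sorted geq p.2, seq_nb p.2 & p.1 == seq_wexp p.2].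
Proof.
elim: m p => [|m IH] [e s] /=.
  by rewrite inE xpair_eqE; case: s => [|a s] /=; rewrite ?andbT ?andbF.
apply/idP/idP.
  rewrite !mem_cat => /or3P[] /mapP[[e' t]].
  - rewrite IH /= => /and4P[/eqP st dt nt /eqP et] [-> ->].
    by rewrite size_rcons st eqxx sorted_geq_rcons0 dt seq_nb_rcons0 nt seq_wexp_rcons0 et eqxx.
  - rewrite mem_filter IH /= => /andP[ht /and4P[/eqP st dt nt /eqP et]] [-> ->].
    rewrite [size _]/= size_map st eqxx; apply/and4P; split=> //.
    + by move: (sorted_geq_consS m.+1 t); rewrite /= dt andbT ltnS ht implybT => ->.
    + by rewrite seq_nb_cons st // eqxx nt.
    + by rewrite seq_wexp_cons st // eqxx et.
  - move=> ht [-> ->]; have [_ /= hd] := nbl_size_head ht.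
    move: ht; rewrite IH /= => /and4P[/eqP st dt nt /eqP et].
    rewrite [size _]/= size_map st eqxx; apply/and4P; split=> //.
    + by move: (sorted_geq_consS m.+2 t); rewrite /= dt andbT ltnS hd implybT => ->.
    + by rewrite seq_nb_cons st // eqxx orbT nt.
    + by rewrite seq_wexp_cons st // [m.+2 == _]gtn_eqF // et.
case/and4P=> /eqP ss ds ns /eqP ->; rewrite !mem_cat.
case: (seq_pos_cases ds) => [s0|[t Es]|[a [t [Es a0]]]]; first by rewrite s0 in ss.
  apply/or3P; constructor 1; apply/mapP; exists (seq_wexp t, t).
    move: ss ds ns; rewrite Es size_rcons sorted_geq_rcons0 seq_nb_rcons0 IH /= => -[->] -> ->.
    by rewrite !eqxx.
  by rewrite Es /= seq_wexp_rcons0.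
have st : size t = m by move: ss; rewrite Es /= size_map => -[].
have : nb_row s 0 by move/allP: ns; apply; rewrite mem_iota ss.
rewrite /nb_row Es /= a0 conj_part_cons0 // st /= => aE.
have ma : (size t < a)%N by rewrite st; case/orP: aE => /eqP ->.
move: ns ds; rewrite Es seq_nb_cons // sorted_geq_consS seq_wexp_cons // st => /andP[_ nt] /andP[ht dt].
have tin : (seq_wexp t, t) \in nbl m by rewrite IH /= st dt nt !eqxx.
case/orP: aE => /eqP aE; rewrite aE in ht *.
  apply/or3P; constructor 2; apply/mapP; exists (seq_wexp t, t); last by rewrite eqxx.
  rewrite mem_filter tin andbT /=; move: ht; case: (t) => //=.
apply/or3P; constructor 3; apply/mapP; exists (seq_wexp t, t) => //.
by rewrite gtn_eqF.
Qed.

Lemma nbl_uniq m : uniq (nbl m).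
Proof.
elim: m => [//|m IH] /=.
have inj0 : injective (fun p : nat * seq nat => (p.1, rcons p.2 0%N)).
  by case=> [e s] [e' s'] /= [-> /eqP]; rewrite eqseq_rcons => /andP[/eqP -> _].
have inj1 k : injective (fun p : nat * seq nat => (p.1.+1, k :: map S p.2)).
  by case=> [e s] [e' s'] /= [-> E]; rewrite (inj_map succn_inj E).
have inj2 k : injective (fun p : nat * seq nat => (p.1, k :: map S p.2)).
  by case=> [e s] [e' s'] /= [-> E]; rewrite (inj_map succn_inj E).
rewrite !cat_uniq (map_inj_uniq inj0) (map_inj_uniq (inj1 _)) (map_inj_uniq (inj2 _)).
rewrite filter_uniq IH //= andbT.
apply/andP; split.
  apply/hasPn => x; rewrite mem_cat => /orP[] /mapP[[e s]] _ ->; apply/negP => /mapP[[e' s'] _ [_ E]];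
    have := congr1 (last 0%N) E; rewrite last_rcons /=; case/lastP: (s) => [//|t y];
    by rewrite map_rcons last_rcons.
apply/hasPn => x /mapP[[e s] _ ->]; apply/negP => /mapP[[e' s'] _ [_ E _]].
by move: E; lia.
Qed.

(** * Near-balanced shapes as sequences *)

Section ShapesAsSeqs.
Variable n : nat.
Local Notation shape := {ffun 'I_n -> 'I_n.+2}.

Definition seq_of_shape (l : shape) : seq nat := [seq (l i : nat) | i <- enum 'I_n].
Definition shape_of_seq (s : seq nat) : shape := [ffun i : 'I_n => inord (nth 0%N s i)].
Definition shape_dec (l : shape) : bool :=
  [forall r : 'I_n, forall r' : 'I_n, (r' == r.+1 :> nat) ==> (l r' <= l r)%N].

Lemma size_seq_of_shape l : size (seq_of_shape l) = n.
Proof. by rewrite size_map size_enum_ord. Qed.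

Lemma nth_seq_of_shape l (i : 'I_n) : nth 0%N (seq_of_shape l) i = l i.
Proof. by rewrite (nth_map i) ?size_enum_ord // nth_ord_enum. Qed.

Lemma seq_of_shapeK : cancel seq_of_shape shape_of_seq.
Proof.
by move=> l; apply/ffunP=> i; rewrite ffunE nth_seq_of_shape; apply: val_inj; rewrite /= inordK.
Qed.

Lemma shape_of_seqK s : size s = n -> (forall a, a \in s -> (a <= n.+1)%N) ->
  seq_of_shape (shape_of_seq s) = s.
Proof.
move=> ss sn; apply: (@eq_from_nth _ 0%N) => [|i]; rewrite size_seq_of_shape ?ss // => lt_i.
rewrite -[i]/(nat_of_ord (Ordinal lt_i)) nth_seq_of_shape ffunE inordK //= ltnS sn //.
by rewrite mem_nth ?ss.
Qed.

Lemma shape_decE l : shape_dec l = sorted geq (seq_of_shape l).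
Proof.
apply/idP/(sortedP 0%N) => [/forallP h i|h].
  rewrite size_seq_of_shape => lt_i.
  move/forallP/(_ (Ordinal lt_i))/implyP: (h (Ordinal (ltnW lt_i))); rewrite /= eqxx => /(_ isT).
  by rewrite -!nth_seq_of_shape.
apply/forallP=> r; apply/forallP=> r'; apply/implyP=> /eqP Er.
by have := h r; rewrite size_seq_of_shape -Er => /(_ (ltn_ord _)) /=; rewrite !nth_seq_of_shape.
Qed.

Lemma in_shape_diag (l : shape) i : in_shape l (i, diagc i) = (i < l i)%N.
Proof. by []. Qed.

Lemma shape_armE (l : shape) i : shape_arm l i = (l i - i.+1)%N.
Proof.
rewrite /shape_arm -sum1_card.
rewrite (eq_bigl (fun c : 'I_n.+1 => (true && (i.+1 <= c))%N && (c < l i)%N)); last first.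
  by move=> c; rewrite inE /in_shape.
have ln : (l i <= n.+1)%N by rewrite -ltnS.
rewrite (eq_bigl (fun c : 'I_n.+1 => (c < l i) && (i.+1 <= c))%N) => [|c]; last by rewrite andbC.
rewrite -(big_geq_mkord _ _ (fun c => c < l i)%N (fun=> 1%N)) /=.
by rewrite -(big_nat_widen _ _ _ xpredT _ ln) sum_nat_const_nat muln1.
Qed.

Lemma conj_part_shape (l : shape) i : conj_part (seq_of_shape l) i = #|[set r : 'I_n | (i < l r)%N]|.
Proof.
rewrite /conj_part count_map -sum1_count -sum1_card big_enum_cond /=.
by apply: eq_bigl => r; rewrite inE.
Qed.

Lemma shape_legE (l : shape) (i : 'I_n) : shape_dec l -> (i < l i)%N ->
  conj_part (seq_of_shape l) i = (i.+1 + shape_leg l i)%N.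
Proof.
move=> dl il; rewrite conj_part_shape.
have dec (r r' : 'I_n) : (r <= r')%N -> (l r' <= l r)%N.
  have tr : transitive geq by move=> a b c /= h1 h2; apply: leq_trans h2 h1.
  move: dl; rewrite shape_decE => /(sorted_leq_nth tr (leqnn : reflexive geq) 0%N) h rr'.
  by have := h r r'; rewrite !inE size_seq_of_shape !ltn_ord !nth_seq_of_shape; apply.
rewrite -(cardsID [set r : 'I_n | (r < i.+1)%N]) -[X in _ = (X + _)%N](card_ord_lt (ltn_ord i)).
congr (_ + _)%N; apply: eq_card => r; rewrite !inE.
  case: (ltnP r i.+1) => ri; rewrite ?andbF ?andbT //.
  by apply: leq_trans il _; apply: dec.
by rewrite -leqNgt /in_shape andbC.
Qed.

Lemma nb_rowE (l : shape) (i : 'I_n) : shape_dec l ->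
  nb_row (seq_of_shape l) i = (in_shape l (i, diagc i) ==>
     ((shape_arm l i == shape_leg l i) || (shape_arm l i == (shape_leg l i).+1))).
Proof.
move=> dl; rewrite /nb_row nth_seq_of_shape in_shape_diag.
case: (ltnP i (l i)) => //= il; rewrite shape_legE // shape_armE; lia.
Qed.

Lemma shape_nbE (l : shape) : shape_dec l -> shape_nb l = seq_nb (seq_of_shape l).
Proof.
move=> dl; rewrite /seq_nb size_seq_of_shape; apply/forallP/allP => h i.
  by rewrite mem_iota /= add0n => lt_i; rewrite (nb_rowE (Ordinal lt_i)) //; apply: h.
by rewrite -nb_rowE //; apply: h; rewrite mem_iota /= add0n.
Qed.

Lemma shape_nb_wexpE (l : shape) : shape_dec l -> shape_nb l ->
  shape_nb_wexp l = seq_wexp (seq_of_shape l).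
Proof.
move=> dl /forallP nl; rewrite /shape_nb_wexp /seq_wexp size_seq_of_shape -sum1_card.
rewrite (eq_bigl (fun i : 'I_n => in_shape l (i, diagc i))) => [|i]; last by rewrite inE.
rewrite -sum1_count -val_enum_ord big_map big_enum_cond /=.
rewrite !(big_morph Posz PoszD (erefl _)) -big_split /=.
rewrite big_mkcond [RHS]big_mkcond /=; apply: eq_bigr => i _.
rewrite in_shape_diag nth_seq_of_shape; case: (ltnP i (l i)) => //= il.
have := nl i; rewrite in_shape_diag il /= shape_armE shape_legE // => h.
by case: eqP => E; lia.
Qed.

Lemma sum_shapes_nbl (F : fieldType) (w : F) (K : shape -> F) :
  (forall l, ~~ shape_dec l -> K l = 0) ->
  \sum_(l : shape | shape_nb l) w ^ shape_nb_wexp l * K l =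
  \sum_(p <- nbl n) w ^+ p.1 * K (shape_of_seq p.2).
Proof.
move=> K0; pose A := [pred l : shape | shape_nb l && shape_dec l].
transitivity (\sum_(l in A) w ^+ seq_wexp (seq_of_shape l) * K l).
  rewrite big_mkcond [RHS]big_mkcond; apply: eq_bigr => l _; rewrite inE.
  case: (boolP (shape_dec l)) => [dl|/K0 ->]; last by rewrite !mulr0 !if_same.
  by rewrite andbT; case: ifP => // nl; rewrite shape_nb_wexpE.
pose e (l : shape) := (seq_wexp (seq_of_shape l), seq_of_shape l).
transitivity (\sum_(p <- [seq e l | l <- enum A]) w ^+ p.1 * K (shape_of_seq p.2)).
  by rewrite big_map big_enum; apply: eq_bigr => l _; rewrite seq_of_shapeK.
apply: perm_big; apply: uniq_perm.
- by rewrite map_inj_uniq ?enum_uniq // => l l' [_ /(can_inj seq_of_shapeK)].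
- exact: nbl_uniq.
move=> [k s]; rewrite mem_nbl /=; apply/mapP/and4P.
  case=> l; rewrite mem_enum inE => /andP[nl dl] [-> ->].
  by rewrite size_seq_of_shape -shape_decE -shape_nbE.
case=> /eqP ss ds ns /eqP ek.
have tr : transitive geq by move=> a b c /= h1 h2; apply: leq_trans h2 h1.
have sn a : a \in s -> (a <= n.+1)%N.
  have kin : (k, s) \in nbl n by rewrite mem_nbl /= ss ds ns ek !eqxx.
  have [_ /= hd] := nbl_size_head kin; case: (s) ds hd => //= b t.
  rewrite (path_sortedE tr) => /andP[/allP h _] hb; rewrite inE => /orP[/eqP ->//|/h /= ab].
  exact: leq_trans ab hb.
exists (shape_of_seq s); last by rewrite /e shape_of_seqK // ek.
have dl : shape_dec (shape_of_seq s) by rewrite shape_decE shape_of_seqK.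
by rewrite mem_enum inE dl andbT shape_nbE // shape_of_seqK.
Qed.

End ShapesAsSeqs.

(** * The identity over a field *)

Lemma vdm_det (F : comNzRingType) (X : nat -> F) n :
  vdm X n = \det (Vandermonde n (\row_(i < n) X i)).
Proof.
rewrite det_Vandermonde [RHS](exchange_big_dep xpredT) //=; apply: eq_bigr => b _.
rewrite (big_ord_widen n (fun a => X b - X a)) 1?ltnW //.
by apply: eq_bigr => a _; rewrite !mxE.
Qed.

Section Reversal.
Variables (F : comNzRingType) (X : nat -> F) (n : nat).
Local Notation Y := (fun i : nat => X (n - i.+1)%N).
Local Notation rev := (perm (@rev_ord_inj n)).

(** Layers use the variables in reverse order. The Vandermonde product and the final determinant
    both change by the sign of the reversal, so the identity is unaffected. *)
Lemma vdm_rev : vdm Y n = (-1) ^+ rev * vdm X n.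
Proof.
rewrite !vdm_det -det_perm -[\det (Vandermonde n (\row_(i < n) X i))]det_tr -det_mulmx -row_permE -det_tr.
by congr (\det _); apply/matrixP=> i j; rewrite !mxE permE.
Qed.

Lemma det_powdiff_rev (f g : F -> F) :
  \det (powdiff_mx (fun i : 'I_n => f (Y i)) (fun i : 'I_n => g (Y i))) =
  (-1) ^+ rev * \det (powdiff_mx (fun i : 'I_n => f (X i)) (fun i : 'I_n => g (X i))).
Proof.
rewrite -det_perm -det_mulmx -row_permE.
by congr (\det _); apply/matrixP=> i j; rewrite !mxE permE.
Qed.
End Reversal.

Section FieldIdentity.
Variables (F : fieldType) (u v w : F) (n : nat).
Hypotheses (u0 : u != 0) (v0 : v != 0) (w0 : w != 0).
Local Notation shape := {ffun 'I_n -> 'I_n.+2}.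
Local Notation empty := ([ffun=> ord0] : shape).

Lemma chainv_shape_dec (Y : nat -> F) i (l : shape) : (0 < i)%N -> ~~ shape_dec l ->
  chainv empty (@shape_transfer _ u v w Y n) i l = 0.
Proof.
case: i => //= i _ nl; apply: big1 => m _.
suff -> : shape_transfer u v w Y i m l = 0 by rewrite mulr0.
apply: big1 => S _; rewrite /layer_transfer /=.
case: (boolP (interlace m l)) => [/forallP ml|_]; last by rewrite mul0r.
case/negP: nl; apply/forallP=> r; apply/forallP=> r'; apply/implyP=> /eqP Er.
have /andP[h1 h2] := ml r; apply: leq_trans h2; apply: leq_trans h1.
by rewrite -Er part_val.
Qed.

Lemma sbcspp_det (X : nat -> F) : (0 < n)%N -> (forall i, X i != 0) -> (forall i, v + w * X i != 0) ->
  vdm X n * \sum_(D : sbcspp n | is_sbcspp D) sbcspp_weight u v w (fun k : 'I_n => X k) D =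
  (\prod_(i < n) X i ^+ n) *
    \det (powdiff_mx (fun i : 'I_n => u * X i) (fun i : 'I_n => - w - v / X i)).
Proof.
move=> n0 X0 Xq; rewrite sum_sbcspp_shapes //; set Y := fun i : nat => X (n - i.+1)%N.
have Y0 i : Y i != 0 by apply: (X0 (n - i.+1)%N).
have Yq i : v + w * Y i != 0 by apply: (Xq (n - i.+1)%N).
rewrite sum_shapes_nbl; last first.
  by move=> l; apply: chainv_shape_dec.
have sgnK (s : bool) : (-1) ^+ s * (-1) ^+ s = 1 :> F by rewrite -expr2 sqrr_sign.
(* The same sign occurs in [shape_gf_det] and in [nbl_phi_det]; both sides are multiplied by it so
   that these lemmas apply. *)
set E := \prod_(i < n) (-1) ^+ i : F.
have E0 : E != 0 by apply/prodf_neq0 => i _; rewrite signr_eq0.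
apply: (mulfI E0).
set r := perm (@rev_ord_inj n).
have -> : vdm X n = (-1) ^+ r * vdm Y n by rewrite vdm_rev mulrA sgnK mul1r.
have -> : \det (powdiff_mx (fun i : 'I_n => u * X i) (fun i : 'I_n => - w - v / X i)) =
  (-1) ^+ r * \det (powdiff_mx (fun i : 'I_n => u * Y i) (fun i : 'I_n => - w - v / Y i)).
  by rewrite (det_powdiff_rev X n (fun x => u * x) (fun x => - w - v / x)) mulrA sgnK mul1r.
have -> : \prod_(i < n) X i ^+ n = \prod_(i < n) Y i ^+ n.
  by rewrite (reindex_inj rev_ord_inj).
rewrite -mulrA mulrCA [RHS]mulrA [RHS]mulrCA; congr (_ * _).
rewrite -nbl_phi_det => [|i]; last exact: Y0.
rewrite mulrA big_distrr /= big_seq [RHS]big_seq; apply: eq_bigr => p pin.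
rewrite mulrCA; congr (_ * _); rewrite -mulrA.
move: (pin); rewrite mem_nbl => /and4P[/eqP sp dp _ _].
have [_ hp] := nbl_size_head pin.
have tr : transitive geq by move=> a b c /= h1 h2; apply: leq_trans h2 h1.
have sn a : a \in p.2 -> (a <= n.+1)%N.
  case: (p.2) dp hp => //= b t; rewrite (path_sortedE tr) => /andP[/allP h _] hb.
  rewrite inE => /orP[/eqP ->//|/h /= ab]; exact: leq_trans ab hb.
have lE (j : 'I_n) : (shape_of_seq n p.2 j : nat) = nth 0%N p.2 j.
  by rewrite ffunE inordK // ltnS sn // mem_nth ?sp.
have -> : shape_of_seq n p.2 = padf ord0 n (shape_of_seq n p.2).
  by apply/ffunP=> j; rewrite (padf_lt _ _ (b := j)).
rewrite shape_gf_det //; first by congr (\det _); apply/matrixP=> j i; rewrite !mxE lE.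
  move=> b b' bb'; rewrite !lE; have /(sortedP 0%N) h := dp.
  by have := h b; rewrite sp -bb' ltn_ord => /(_ isT).
Qed.

Lemma amt_sbcspp_field (X : nat -> F) : (0 < n)%N ->
  (forall i, X i != 0) -> (forall i, v + w * X i != 0) -> vdm X n != 0 ->
  \sum_(A : amt n | is_amt A) amt_weight u v w (fun i : 'I_n => X i) A =
  \sum_(D : sbcspp n | is_sbcspp D) sbcspp_weight u v w (fun k : 'I_n => X k) D.
Proof.
by move=> n0 X0 Xq V0; apply: (mulfI V0); rewrite amt_det // sbcspp_det.
Qed.

End FieldIdentity.

(** * Specialization from the generic point *)

Section Laurent.
Variable n : nat.

(** The exponent of u is a natural number because u need not be invertible. *)
Record lexp := LExp { exp_u : nat; exp_v : int; exp_w : int; exp_X : 'I_n -> int }.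

Definition lmon (R : comUnitRingType) (u v w : R) (X : 'I_n -> R) (e : lexp) : R :=
  u ^+ exp_u e * v ^ exp_v e * w ^ exp_w e * \prod_i X i ^ exp_X e i.

(* Multiplying by [N]-th powers turns a Laurent monomial into an honest monomial,
   whose value makes sense at the variables of a polynomial ring. *)
Definition nmon (R : comNzRingType) (N : nat) (u v w : R) (X : 'I_n -> R) (e : lexp) : R :=
  u ^+ exp_u e * v ^+ absz (N%:Z + exp_v e) * w ^+ absz (N%:Z + exp_w e) *
  \prod_i X i ^+ absz (N%:Z + exp_X e i).

Definition lexp_size (e : lexp) : nat :=
  (absz (exp_v e) + absz (exp_w e) + \sum_i absz (exp_X e i))%N.

Lemma exprz_shift (R : unitRingType) (x : R) N z : x \is a GRing.unit -> (absz z <= N)%N ->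
  x ^+ absz (N%:Z + z) = x ^+ N * x ^ z.
Proof.
move=> ux zN; rewrite [x ^+ N]exprnP -exprzDr // [LHS]exprnP.
by congr (_ ^ _); lia.
Qed.

Lemma nmon_lmon (R : comUnitRingType) N (u v w : R) (X : 'I_n -> R) (e : lexp) :
  v \is a GRing.unit -> w \is a GRing.unit -> (forall i, X i \is a GRing.unit) ->
  (lexp_size e <= N)%N ->
  nmon N u v w X e = (v ^+ N * w ^+ N * \prod_i X i ^+ N) * lmon u v w X e.
Proof.
move=> uv uw uX eN; rewrite /nmon /lmon !exprz_shift //; try by move: eN; rewrite /lexp_size; lia.
under eq_bigr => i _.
  rewrite exprz_shift //; last first.
    apply: leq_trans eN; rewrite /lexp_size (bigD1 i) //=; lia.
  over.
rewrite big_split /=.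
move: (\prod_i X i ^+ N) (\prod_i X i ^ _) (u ^+ _) (v ^+ N) (v ^ _) (w ^+ N) (w ^ _) => a b c d f g h.
by ring.
Qed.

Lemma nmon_morph (R S : comNzRingType) (f : {rmorphism R -> S}) N u v w X e :
  f (nmon N u v w X e) = nmon N (f u) (f v) (f w) (fun i => f (X i)) e.
Proof.
by rewrite /nmon !rmorphM rmorph_prod /= !rmorphXn; congr (_ * _); apply: eq_bigr => i _; rewrite rmorphXn.
Qed.

Local Notation P := {mpoly int[3 + n]}.

Definition point (R : Type) (u v w : R) (X : 'I_n -> R) (j : 'I_(3 + n)) : R :=
  match split j with
  | inl k => if val k is k'.+1 then (if k' is 0 then v else w) else u
  | inr i => X i
  end.

Lemma point_lshift (R : Type) (u v w : R) (X : 'I_n -> R) (k : 'I_3) :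
  point u v w X (lshift n k) = if val k is k'.+1 then (if k' is 0 then v else w) else u.
Proof. by rewrite /point (unsplitK (inl k)). Qed.

Lemma point_rshift (R : Type) (u v w : R) (X : 'I_n -> R) (i : 'I_n) :
  point u v w X (rshift 3 i) = X i.
Proof. by rewrite /point (unsplitK (inr i)). Qed.

Definition gen_u : P := 'X_(lshift n (@Ordinal 3 0 isT)).
Definition gen_v : P := 'X_(lshift n (@Ordinal 3 1 isT)).
Definition gen_w : P := 'X_(lshift n (@Ordinal 3 2 isT)).
Definition gen_X (i : 'I_n) : P := 'X_(rshift 3 i).

(** With denominators cleared, both sides come from integer polynomials. These agree because they
    agree in the fraction field; evaluation carries the equality to R, where the clearing factor is
    a unit. The hypothesis [v + w != 0] accommodates a family X continued by the value 1. *)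
Lemma laurent_transfer (I J : finType) (A : pred I) (B : pred J) (eI : I -> lexp) (eJ : J -> lexp) :
  (forall (F : fieldType) (u v w : F) (X : 'I_n -> F), u != 0 -> v != 0 -> w != 0 ->
     (forall i, X i != 0) -> v + w != 0 -> (forall i, v + w * X i != 0) -> injective X ->
     \sum_(i | A i) lmon u v w X (eI i) = \sum_(j | B j) lmon u v w X (eJ j)) ->
  forall (R : comUnitRingType) (u v w : R) (X : 'I_n -> R),
    v \is a GRing.unit -> w \is a GRing.unit -> (forall i, X i \is a GRing.unit) ->
    \sum_(i | A i) lmon u v w X (eI i) = \sum_(j | B j) lmon u v w X (eJ j).
Proof.
move=> gen R u v w X uv uw uX.
pose N := (\sum_i lexp_size (eI i) + \sum_j lexp_size (eJ j))%N.
have NI i : (lexp_size (eI i) <= N)%N by rewrite /N (bigD1 i) //=; lia.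
have NJ j : (lexp_size (eJ j) <= N)%N by rewrite /N [X in (_ + X)%N](bigD1 j) //=; lia.
have poly_eq : \sum_(i | A i) nmon N gen_u gen_v gen_w gen_X (eI i) =
               \sum_(j | B j) nmon N gen_u gen_v gen_w gen_X (eJ j).
  apply/eqP; rewrite -tofrac_eq; apply/eqP; rewrite !rmorph_sum /=.
  (* Genericity is tested at one integer point: with all variables equal to 1, a variable takes the
     value 1 and each of v + w, v + w X_i the value 2. *)
  have nz (p : P) (x : 'I_(3 + n) -> int) : p.@[x] != 0 -> tofrac p != 0 :> {fraction P}.
    by move=> px; rewrite tofrac_eq0; apply: contra_neq px => ->; rewrite meval0.
  have nz1 (k : 'I_(3 + n)) : tofrac ('X_k : P) != 0 :> {fraction P}.
    by apply: (nz _ (fun=> 1)); rewrite mevalXU.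
  have genU (k : 'I_(3 + n)) : tofrac ('X_k : P) \is a @GRing.unit {fraction P} by rewrite unitfE.
  have lmonE N' e : (lexp_size e <= N')%N ->
      tofrac (nmon N' gen_u gen_v gen_w gen_X e) =
      (tofrac gen_v ^+ N' * tofrac gen_w ^+ N' * \prod_i tofrac (gen_X i) ^+ N') *
      lmon (tofrac gen_u) (tofrac gen_v) (tofrac gen_w) (fun i => tofrac (gen_X i)) e.
    by move=> eN; rewrite (nmon_morph (@tofrac P)) nmon_lmon // => *; apply: genU.
  under eq_bigr => i _ do rewrite lmonE //.
  under [RHS]eq_bigr => j _ do rewrite lmonE //.
  rewrite -!big_distrr; congr (_ * _); apply: gen; rewrite ?nz1 //.
  - by move=> i; apply: nz1.
  - by rewrite -tofracD; apply: (nz _ (fun=> 1)); rewrite mevalD !mevalXU.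
  - by move=> i; rewrite -tofracM -tofracD; apply: (nz _ (fun=> 1)); rewrite mevalD mevalM !mevalXU.
  move=> i j /eqP; rewrite tofrac_eq => /eqP E.
  (* Evaluating each X_i at its index i separates the variables. *)
  have := congr1 (meval (point 0 0 0 (fun i : 'I_n => (i : nat)%:Z))) E.
  by rewrite !mevalXU !point_rshift => -[] /val_inj.
pose ev : {rmorphism P -> R} := mmap intr (point u v w X).
have ev_eq := congr1 ev poly_eq.
have evX k : ev 'X_k = point u v w X k by rewrite /ev /= mmapX mmap1U.
have evs e : ev (nmon N gen_u gen_v gen_w gen_X e) = nmon N u v w X e.
  rewrite nmon_morph /nmon !evX !point_lshift; congr (_ * _).
  by apply: eq_bigr => i _; rewrite evX point_rshift.
have Uunit : v ^+ N * w ^+ N * \prod_i X i ^+ N \is a GRing.unit.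
  by rewrite !unitrM !unitrX //=; apply: rpred_prod => i _; apply: unitrX.
apply: (mulrI Uunit); rewrite !big_distrr /=.
under eq_bigr => i _ do rewrite -nmon_lmon // -evs.
under [RHS]eq_bigr => j _ do rewrite -nmon_lmon // -evs.
by rewrite -!rmorph_sum.
Qed.

Definition amt_lexp (A : amt n) : lexp :=
  LExp (cnt A DNE) (cnt A DNW)%:Z (cnt A DBoth)%:Z (amt_xexp A).

Definition sbcspp_lexp (D : sbcspp n) : lexp :=
  LExp (cells_above D) (('C(n.+1, 2))%:Z - (entries_below D)%:Z)
    (shape_wexp D + ((entries D)%:Z - (cells D)%:Z)) (fun k => (count_k D k)%:Z).

Lemma sbcspp_weightE (R : comUnitRingType) (u v w : R) (X : 'I_n -> R) D : w \is a GRing.unit ->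
  sbcspp_weight u v w X D = lmon u v w X (sbcspp_lexp D).
Proof.
move=> uw; rewrite /sbcspp_weight /lmon /= [w ^ (shape_wexp D + _)]exprzDr //.
move: (w ^ shape_wexp D) (w ^ _) (v ^ _) (u ^+ _) => a b c d.
rewrite [\prod_(k : 'I_n) X k ^ _](eq_bigr (fun k => X k ^+ count_k D k)) //.
by move: (\prod_(k < n) _) => e; ring.
Qed.

End Laurent.

Theorem theorem2 (n : nat) (R : comUnitRingType) (u v w : R) (X : 'I_n -> R) :
  (1 <= n)%N ->
  v \is a GRing.unit -> w \is a GRing.unit -> (forall i, X i \is a GRing.unit) ->
  \sum_(A : amt n | is_amt A) amt_weight u v w X A =
  \sum_(D : sbcspp n | is_sbcspp D) sbcspp_weight u v w X D.
Proof.
move=> n0 uv uw uX.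
under [RHS]eq_bigr => D _ do rewrite sbcspp_weightE //.
apply: (laurent_transfer (eI := @amt_lexp n) (eJ := @sbcspp_lexp n)) => //.
move=> F {uv uw uX}u' v' w' X' u0 v0 w0 X0 vw Xq Xinj.
(* The field identity takes a family indexed by all naturals; the default 1 is nonzero, and [vw]
   covers the condition v + w X_i != 0 there. *)
pose Xn i := if insub i is Some j then X' j else 1.
have XnE (i : 'I_n) : Xn i = X' i by rewrite /Xn (valK i).
transitivity (\sum_(A : amt n | is_amt A) amt_weight u' v' w' (fun i : 'I_n => Xn i) A).
  by apply: eq_bigr => A _; congr (_ * _); apply: eq_bigr => i _; rewrite XnE.
rewrite amt_sbcspp_field //.
- apply: eq_bigr => D _; rewrite -sbcspp_weightE ?unitfE //; congr (_ * _).
  by apply: eq_bigr => i _; rewrite XnE.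
- by move=> i; rewrite /Xn; case: insubP => // _; rewrite oner_neq0.
- by move=> i; rewrite /Xn; case: insubP => // _; rewrite mulr1.
apply/prodf_neq0 => b _; apply/prodf_neq0 => a _; rewrite subr_eq0.
have an : (a < n)%N := ltn_trans (ltn_ord a) (ltn_ord b).
rewrite XnE -[a : nat]/(nat_of_ord (Ordinal an)) XnE; apply/eqP => /Xinj/(congr1 val) /= E.
by have := ltn_ord a; rewrite -E ltnn.
Qed.
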